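(* Let $R$ be a commutative ring and let $P_0$ be a projective $R$-module of constant rank $2$ with a fixed trivialization $\theta_0: R \xrightarrow{\cong} \det(P_0)$. Let $N\in\mathbb N$. Assume that an element $\beta$ of $\tilde V(R)$ is of the form $[P_{2N+2},\chi_0\perp\psi_{2N},\chi]$ for some non-degenerate alternating form $\chi$ on $P_{2N+2}$. Moreover, assume that $\pi_{2n+1,2n+1}(E_\infty(P_0)\cap Aut(P_{2n+1}))=Um(P_{2n+1})$ for any $n\in\mathbb N$ with $1<n\leq N$. Then $\beta$ lies in the image of the generalized Vaserstein symbol $V:Um(P_0\oplus R)\to\tilde V(R)$. Thus, the generalized Vaserstein symbol $V:Um(P_0\oplus R)\to\tilde V(R)$ is surjective if $\pi_{2n+1,2n+1}(E_\infty(P_0)\cap Aut(P_{2n+1}))=Um(P_{2n+1})$ for all $n\geq2$.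
   Context: Modules: for $n\ge3$, $P_n=P_0\oplus Re_3\oplus\dots\oplus Re_n$ with $Re_i$ free of rank $1$ on $e_i$ (so $P_3=P_0\oplus R$, $P_4=P_0\oplus R^2$); $\pi_{k,n}:P_n\to R$ is the projection onto the summand $Re_k\cong R$. $Um(M)$ is the set of surjective $R$-linear maps $M\to R$, with right action of $Aut(M)$ by precomposition; $aH=\{a\varphi:\varphi\in H\}$ for $H\subset Aut(M)$. For $M=\bigoplus_i M_i$, $E(M)\subset Aut(M)$ is generated by the automorphisms $id_M+s$ with $s:M_j\to M_i$ linear, $i\ne j$; $E(P_n)$ is taken with respect to $P_0,Re_3,\dots,Re_n$. Via $\varphi\mapsto\varphi\oplus id$, $Aut(P_n)\subset Aut(P_{n+1})$ and $E(P_n)\subset E(P_{n+1})$; $E_\infty(P_0)=\varinjlim E(P_n)$ inside $Aut_\infty(P_0)=\varinjlim Aut(P_n)$, where intersections are taken. Forms: an alternating isomorphism on a finitely generated projective module $P$ is an isomorphism $f: P\to P^\vee$ with $f(p)(p)=0$ for all $p$; it is the same as a non-degenerate alternating form $\chi$ on $P$ via $f(q)=\chi(-,q)$. For a linear map $\alpha$, $\alpha^t\chi\alpha$ denotes $(x,y)\mapsto\chi(\alpha x,\alpha y)$; $\perp$ is the orthogonal sum. $\psi_2=\begin{pmatrix}0&1\\-1&0\end{pmatrix}$ on $R^2$, $\psi_{2n+2}=\psi_{2n}\perp\psi_2$. The group $V(R)$: triples $(P,g,f)$ with $P$ finitely generated projective and $f,g$ alternating isomorphisms on $P$; $(P,f_0,f_1)$,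 $(P',f_0',f_1')$ are isometric if there is an isomorphism $h:P\to P'$ with $f_i=h^\vee f_i' h$ for $i=0,1$. $V(R)$ is the quotient of the free abelian group on isometry classes $[P,g,f]$ by the relations $[P\oplus P',g\perp g',f\perp f']=[P,g,f]+[P',g',f']$ and $[P,f_0,f_1]+[P,f_1,f_2]=[P,f_0,f_2]$. The same construction with free modules gives $V_{free}(R)$, and $V_{free}(R)\to V(R)$ is an isomorphism; hence there is a unique homomorphism $\overline{Pf}:V(R)\to R^\times$ with $[R^{2n},g,f]\mapsto Pf(f)Pf(g)^{-1}$ (Pfaffians of alternating invertible matrices). $\tilde V(R)=\ker\overline{Pf}$. Generalized Vaserstein symbol: $\chi_0$ is the form $(p,q)\mapsto\theta_0^{-1}(p\wedge q)$ on $P_0$. For $a\in Um(P_0\oplus R)$ with section $s$, let $P(a)=\ker a$, $i:P_0\oplus R\to P(a)\oplus R$, $i(p)=(p-s(a(p)),a(p))$, and $\chi_a(p,q)=\theta^{-1}(p\wedge q)$ on $P(a)$, where $\theta$ is $\theta_0$ followed by $\det(P_0)\cong\det(P_0\oplus R)\cong\det(P(a))$ (the first map is $w\mapsto w\wedge e_3$, the second the inverse of $w\mapsto w\wedge s(1)$). Then $V(a)=[P_0\oplus R^2,\chi_0\perp\psi_2,(i\oplus1)^t(\chi_a\perp\psi_2)(i\oplus1)]\in\tilde V(R)$, independent of $s$. *)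

(* Defs.v *)
From HB Require Import structures.
From mathcomp Require Import all_boot all_order perm all_algebra.
From mathcomp Require Import all_classical.

Set Implicit Arguments.
Unset Strict Implicit.
Unset Printing Implicit Defensive.
Import GRing.Theory.

Local Open Scope classical_set_scope.
Local Open Scope ring_scope.

Section ExteriorPower.
Variables (R : comPzRingType) (M : lmodType R) (k : nat).

Definition upd (v : 'I_k -> M) (i : 'I_k) (x : M) : 'I_k -> M :=
  fun j => if j == i then x else v j.

Definition alternating_multilinear (N : lmodType R) (f : ('I_k -> M) -> N) :=
  (forall v i a x y,
     f (upd v i (a *: x + y)) = a *: f (upd v i x) + f (upd v i y)) /\
  (forall v i j, i != j -> v i = v j -> f v = 0).

(* The k-th exterior power is the R-module presented by the generators
   v_0 /\ ... /\ v_(k-1) and the multilinearity and alternation relations: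
   [ext_eq] is the least R-module congruence on formal expressions in these
   generators that contains the relations. *)
Inductive ext_term : Type :=
  | EWedge of 'I_k -> M
  | EZero
  | EOpp of ext_term
  | EAdd of ext_term & ext_term
  | EScale of R & ext_term.

Inductive ext_eq : ext_term -> ext_term -> Prop :=
  | ext_refl s : ext_eq s s
  | ext_sym s t : ext_eq s t -> ext_eq t s
  | ext_trans s t u : ext_eq s t -> ext_eq t u -> ext_eq s u
  | ext_opp s t : ext_eq s t -> ext_eq (EOpp s) (EOpp t)
  | ext_add s s' t t' :
      ext_eq s s' -> ext_eq t t' -> ext_eq (EAdd s t) (EAdd s' t')
  | ext_scale a s t : ext_eq s t -> ext_eq (EScale a s) (EScale a t)
  | ext_addA s t u : ext_eq (EAdd s (EAdd t u)) (EAdd (EAdd s t) u)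
  | ext_addC s t : ext_eq (EAdd s t) (EAdd t s)
  | ext_add0 s : ext_eq (EAdd EZero s) s
  | ext_addN s : ext_eq (EAdd (EOpp s) s) EZero
  | ext_scaleA a b s : ext_eq (EScale a (EScale b s)) (EScale (a * b) s)
  | ext_scale1 s : ext_eq (EScale 1 s) s
  | ext_scaleDr a s t :
      ext_eq (EScale a (EAdd s t)) (EAdd (EScale a s) (EScale a t))
  | ext_scaleDl a b s :
      ext_eq (EScale (a + b) s) (EAdd (EScale a s) (EScale b s))
  | ext_multilinear v i a x y :
      ext_eq (EWedge (upd v i (a *: x + y)))
             (EAdd (EScale a (EWedge (upd v i x))) (EWedge (upd v i y)))
  | ext_alternating v i j : i != j -> v i = v j -> ext_eq (EWedge v) EZero.

HB.instance Definition _ := gen_eqMixin ext_term.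
HB.instance Definition _ := gen_choiceMixin ext_term.

Definition ext_eqb (s t : ext_term) : bool := `[< ext_eq s t >].

Lemma ext_eqb_equiv : equiv_class_of ext_eqb.
Proof.
split=> [s|s t|t s u].
- by apply/asboolP; apply: ext_refl.
- by apply/asboolP/asboolP; apply: ext_sym.
- by move=> /asboolP st /asboolP tu; apply/asboolP; apply: ext_trans st tu.
Qed.

Canonical ext_equiv := EquivRelPack ext_eqb_equiv.

Definition ext : Type := {eq_quot ext_equiv}%qT.

HB.instance Definition _ := Choice.on ext.

Definition ext_cls (s : ext_term) : ext := \pi_{eq_quot ext_equiv}%qT s.

Lemma ext_clsP s t : ext_cls s = ext_cls t <-> ext_eq s t.
Proof.
by split=> [/eqP|st]; [rewrite eqmodE => /asboolP | apply/eqP; rewrite eqmodE; apply/asboolP].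
Qed.

Definition ext_repr (x : ext) : ext_term := (repr x : ext_term).

Lemma ext_reprK x : ext_cls (ext_repr x) = x.
Proof. exact: reprK. Qed.

Lemma ext_repr_cls s : ext_eq (ext_repr (ext_cls s)) s.
Proof. by apply/ext_clsP; rewrite ext_reprK. Qed.

Definition ext_vzero : ext := ext_cls EZero.
Definition ext_vopp (x : ext) : ext := ext_cls (EOpp (ext_repr x)).
Definition ext_vadd (x y : ext) : ext :=
  ext_cls (EAdd (ext_repr x) (ext_repr y)).
Definition ext_vscale (a : R) (x : ext) : ext :=
  ext_cls (EScale a (ext_repr x)).

Lemma ext_clsN s : ext_vopp (ext_cls s) = ext_cls (EOpp s).
Proof. by apply/ext_clsP/ext_opp/ext_repr_cls. Qed.

Lemma ext_clsD s t : ext_vadd (ext_cls s) (ext_cls t) = ext_cls (EAdd s t).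
Proof. by apply/ext_clsP/ext_add; apply: ext_repr_cls. Qed.

Lemma ext_clsZ a s : ext_vscale a (ext_cls s) = ext_cls (EScale a s).
Proof. by apply/ext_clsP/ext_scale/ext_repr_cls. Qed.

Lemma ext_vaddA : associative ext_vadd.
Proof.
move=> x y z; rewrite -[x]ext_reprK -[y]ext_reprK -[z]ext_reprK.
by rewrite !ext_clsD; apply/ext_clsP/ext_addA.
Qed.

Lemma ext_vaddC : commutative ext_vadd.
Proof.
move=> x y; rewrite -[x]ext_reprK -[y]ext_reprK !ext_clsD.
exact/ext_clsP/ext_addC.
Qed.

Lemma ext_vadd0 : left_id ext_vzero ext_vadd.
Proof.
by move=> x; rewrite -[x]ext_reprK ext_clsD; apply/ext_clsP/ext_add0.
Qed.

Lemma ext_vaddN : left_inverse ext_vzero ext_vopp ext_vadd.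
Proof.
by move=> x; rewrite -[x]ext_reprK ext_clsN ext_clsD; apply/ext_clsP/ext_addN.
Qed.

HB.instance Definition _ :=
  GRing.isZmodule.Build ext ext_vaddA ext_vaddC ext_vadd0 ext_vaddN.

Lemma ext_addE (x y : ext) : x + y = ext_vadd x y.
Proof. by []. Qed.

Lemma ext_vscaleA a b x :
  ext_vscale a (ext_vscale b x) = ext_vscale (a * b) x.
Proof.
by rewrite -[x]ext_reprK !ext_clsZ; apply/ext_clsP/ext_scaleA.
Qed.

Lemma ext_vscale1 : left_id 1 ext_vscale.
Proof.
by move=> x; rewrite -[x]ext_reprK ext_clsZ; apply/ext_clsP/ext_scale1.
Qed.

Lemma ext_vscaleDr : right_distributive ext_vscale +%R.
Proof.
move=> a x y; rewrite -[x]ext_reprK -[y]ext_reprK.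
rewrite !ext_addE ext_clsD !ext_clsZ ext_clsD.
exact/ext_clsP/ext_scaleDr.
Qed.

Lemma ext_vscaleDl x : {morph ext_vscale^~ x : a b / a + b}.
Proof.
move=> a b; rewrite -[x]ext_reprK ext_addE !ext_clsZ ext_clsD.
exact/ext_clsP/ext_scaleDl.
Qed.

HB.instance Definition _ := GRing.Zmodule_isLmodule.Build R ext
  ext_vscaleA ext_vscale1 ext_vscaleDr ext_vscaleDl.

Lemma ext_scaleE a (x : ext) : a *: x = ext_vscale a x.
Proof. by []. Qed.

Definition wedge (v : 'I_k -> M) : ext := ext_cls (EWedge v).

Lemma wedge_alternating_multilinear : alternating_multilinear wedge.
Proof.
split=> [v i a x y|v i j nij vij].
  rewrite ext_scaleE ext_addE ext_clsZ ext_clsD.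
  exact/ext_clsP/ext_multilinear.
exact/ext_clsP/(ext_alternating nij).
Qed.

Section Lift.
Variables (N : lmodType R) (f : ('I_k -> M) -> N).
Hypothesis fP : alternating_multilinear f.

Fixpoint ext_eval (s : ext_term) : N :=
  match s with
  | EWedge v => f v
  | EZero => 0
  | EOpp t => - ext_eval t
  | EAdd t u => ext_eval t + ext_eval u
  | EScale a t => a *: ext_eval t
  end.

Lemma ext_eval_eq s t : ext_eq s t -> ext_eval s = ext_eval t.
Proof.
elim=> {s t} //=.
- by move=> s t u _ -> _ ->.
- by move=> s t _ ->.
- by move=> s s' t t' _ -> _ ->.
- by move=> a s t _ ->.
- by move=> *; rewrite addrA.
- by move=> *; rewrite addrC.
- by move=> *; rewrite add0r.
- by move=> *; rewrite addNr.
- by move=> *; rewrite scalerA.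
- by move=> *; rewrite scale1r.
- by move=> *; rewrite scalerDr.
- by move=> *; rewrite scalerDl.
- by move=> *; rewrite fP.1.
- by move=> v i j; apply: fP.2.
Qed.

Definition ext_lift_of & alternating_multilinear f :=
  fun x : ext => ext_eval (ext_repr x).

Local Notation lift := (ext_lift_of fP).

Lemma ext_lift_cls s : lift (ext_cls s) = ext_eval s.
Proof. exact/ext_eval_eq/ext_repr_cls. Qed.

Lemma ext_lift_linear : linear lift.
Proof.
move=> a x y; rewrite -[x]ext_reprK -[y]ext_reprK.
by rewrite ext_scaleE ext_addE ext_clsZ ext_clsD !ext_lift_cls.
Qed.

HB.instance Definition _ :=
  GRing.isLinear.Build R ext N *:%R lift ext_lift_linear.

Definition ext_lift : {linear ext -> N} := lift.

Lemma ext_liftE v : ext_lift (wedge v) = f v.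
Proof. exact: ext_lift_cls. Qed.

End Lift.

End ExteriorPower.

Definition wedge2 (R : comPzRingType) (M : lmodType R) (p q : M) : ext M 2 :=
  wedge (tnth [tuple p; q]).

Section WedgeRight.
Variables (R : comPzRingType) (M N : lmodType R) (k : nat).
Variables (h : {linear N -> M}) (x : M).

Definition rcons_family (v : 'I_k -> N) : 'I_k.+1 -> M :=
  fun i => if unlift ord_max i is Some j then h (v j) else x.

Lemma rcons_family_upd v i y :
  rcons_family (upd v i y) = upd (rcons_family v) (lift ord_max i) (h y).
Proof.
apply/funext => j; rewrite /rcons_family /upd.
case: unliftP => [j' ->|->]; first by rewrite (inj_eq lift_inj); case: eqP.
by rewrite (negPf (neq_lift _ _)).
Qed.

Lemma wedge_rcons_family :
  alternating_multilinear (fun v => wedge (rcons_family v)).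
Proof.
have [wl wa] := wedge_alternating_multilinear M k.+1.
split=> [v i a y z|v i j nij vij].
  by rewrite !rcons_family_upd linearP wl.
apply: (wa _ (lift ord_max i) (lift ord_max j)).
  by rewrite (inj_eq lift_inj).
by rewrite /rcons_family !liftK vij.
Qed.

(* w |-> w /\ x, where w is pushed forward along h *)
Definition wedge_right : {linear ext N k -> ext M k.+1} :=
  ext_lift wedge_rcons_family.

End WedgeRight.

Section Projective.
Variable R : comPzRingType.

Definition fg_projective (M : lmodType R) : Prop :=
  exists n (p : {linear 'rV[R]_n -> M}) (s : {linear M -> 'rV[R]_n}),
    cancel s p.

Definition prime_ideal (p : set R) : Prop :=
  [/\ p 0, forall x y, p x -> p y -> p (x + y), forall a x, p x -> p (a * x),
      ~ p 1 & forall x y, p (x * y) -> p x \/ p y].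

(* x / 1 = 0 in the localization of M at p *)
Definition vanishes_at (p : set R) (M : lmodType R) (x : M) : Prop :=
  exists2 u, ~ p u & u *: x = 0.

(* The localization of M at p is free of rank r over that of R. Since
   denominators are units there, a basis may be taken of the form e_i / 1; the
   two clauses say that the e_i / 1 generate and are linearly independent. *)
Definition locally_free_at (p : set R) (M : lmodType R) (r : nat) : Prop :=
  exists e : 'I_r -> M,
    (forall x, exists2 u, ~ p u & exists c : 'I_r -> R,
        u *: x = \sum_i c i *: e i) /\
    (forall c : 'I_r -> R, vanishes_at p (\sum_i c i *: e i) ->
        forall i, vanishes_at p (c i : R^o)).

Definition constant_rank (r : nat) (M : lmodType R) : Prop :=
  forall p, prime_ideal p -> locally_free_at p M r.

End Projective.

Section Forms.
Variable R : comPzRingType.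

(* An alternating isomorphism f : P -> P^v is represented by the form
   chi(p, q) = f(q)(p); the last clause says that f is bijective. *)
Record alternating_iso (P : lmodType R) (chi : P -> P -> R^o) : Prop := {
  alt_linearl : forall q, linear (chi^~ q);
  alt_linearr : forall p, linear (chi p);
  alt_alternating : forall p, chi p p = 0;
  alt_bijective : forall l : {linear P -> R^o},
    exists! q, forall p, chi p q = l p }.

Definition perp (P Q : lmodType R) (chi : P -> P -> R^o) (xi : Q -> Q -> R^o) :
    (P * Q)%type -> (P * Q)%type -> R^o :=
  fun x y => chi x.1 y.1 + xi x.2 y.2.

(* chi _|_ psi_2 *)
Definition perp_psi2 (P : lmodType R) (chi : P -> P -> R^o) :
    (P * R^o * R^o)%type -> (P * R^o * R^o)%type -> R^o :=
  fun x y => chi x.1.1 y.1.1 + (x.1.2 * y.2 - x.2 * y.1.2).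

Definition pullback (P Q : lmodType R) (h : P -> Q) (chi : Q -> Q -> R^o) :
    P -> P -> R^o :=
  fun x y => chi (h x) (h y).

Definition is_isometry (P Q : lmodType R) (h : {linear P -> Q})
    (g f : P -> P -> R^o) (g' f' : Q -> Q -> R^o) : Prop :=
  [/\ bijective h, g = pullback h g' & f = pullback h f'].

End Forms.

Section Pfaffian.
Variables (R : comPzRingType) (n : nat).

Lemma even_ord_subproof (i : 'I_n) : (i.*2 < n.*2)%N.
Proof. by rewrite ltn_double. Qed.

Lemma odd_ord_subproof (i : 'I_n) : (i.*2.+1 < n.*2)%N.
Proof. by rewrite ltn_Sdouble. Qed.

Definition even_ord i : 'I_n.*2 := Ordinal (even_ord_subproof i).
Definition odd_ord i : 'I_n.*2 := Ordinal (odd_ord_subproof i).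

(* s enumerates a perfect matching {s 0, s 1}, {s 2, s 3}, ... in its
   normal order: s 0 < s 1, s 2 < s 3, ... and s 0 < s 2 < ... *)
Definition matching (s : 'S_n.*2) : bool :=
  [forall i, (s (even_ord i) < s (odd_ord i))%N] &&
  [forall i : 'I_n, forall j : 'I_n, (i < j)%N ==>
     (s (even_ord i) < s (even_ord j))%N].

Definition Pf (A : 'M[R]_(n.*2)) : R :=
  \sum_(s : 'S_n.*2 | matching s)
    (-1) ^+ s * \prod_(i < n) A (s (even_ord i)) (s (odd_ord i)).

Definition gram (chi : 'rV[R]_n.*2 -> 'rV[R]_n.*2 -> R^o) : 'M[R]_(n.*2) :=
  \matrix_(i, j) chi (delta_mx 0 i) (delta_mx 0 j).

End Pfaffian.

(* Triples quantify over all modules, so that they and V(R) live in a universe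
   too large for the MathComp structures: V(R) is given as a bare quotient with
   its own operations. *)
Section GroupV.
Variable R : comPzRingType.

Record triple := Triple {
  tmod : lmodType R;
  tg : tmod -> tmod -> R^o;
  tf : tmod -> tmod -> R^o;
  tproj : fg_projective tmod;
  tgP : alternating_iso tg;
  tfP : alternating_iso tf }.

Inductive vterm : Type :=
  | VGen of triple
  | VZero
  | VOpp of vterm
  | VAdd of vterm & vterm.

(* The abelian group presented by the triples and the three families of
   relations: isometry, orthogonal sum and composition *)
Inductive veq : vterm -> vterm -> Prop :=
  | veq_refl s : veq s s
  | veq_sym s t : veq s t -> veq t s
  | veq_trans s t u : veq s t -> veq t u -> veq s u
  | veq_opp s t : veq s t -> veq (VOpp s) (VOpp t)
  | veq_add s s' t t' : veq s s' -> veq t t' -> veq (VAdd s t) (VAdd s' t')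
  | veq_addA s t u : veq (VAdd s (VAdd t u)) (VAdd (VAdd s t) u)
  | veq_addC s t : veq (VAdd s t) (VAdd t s)
  | veq_add0 s : veq (VAdd VZero s) s
  | veq_addN s : veq (VAdd (VOpp s) s) VZero
  | veq_isometry (P Q : lmodType R) (h : {linear P -> Q}) g f g' f'
      pP pQ gP fP gP' fP' : is_isometry h g f g' f' ->
      veq (VGen (@Triple P g f pP gP fP)) (VGen (@Triple Q g' f' pQ gP' fP'))
  | veq_perp (P Q : lmodType R) g f g' f' pP pQ pPQ gP fP gP' fP' gPQ fPQ :
      veq (VGen (@Triple (P * Q)%type (perp g g') (perp f f') pPQ gPQ fPQ))
          (VAdd (VGen (@Triple P g f pP gP fP))
                (VGen (@Triple Q g' f' pQ gP' fP')))
  | veq_comp (P : lmodType R) f0 f1 f2 pP f0P f1P f2P :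
      veq (VAdd (VGen (@Triple P f0 f1 pP f0P f1P))
                (VGen (@Triple P f1 f2 pP f1P f2P)))
          (VGen (@Triple P f0 f2 pP f0P f2P)).

Definition V : Type := {C : vterm -> Prop | exists s, C = veq s}.

Definition Vcls (s : vterm) : V := exist _ (veq s) (ex_intro _ s erefl).

Definition Vrepr (x : V) : vterm := sval (cid (svalP x)).

Definition V0 : V := Vcls VZero.
Definition Vopp (x : V) : V := Vcls (VOpp (Vrepr x)).
Definition Vadd (x y : V) : V := Vcls (VAdd (Vrepr x) (Vrepr y)).

Lemma V_inj (x y : V) : sval x = sval y -> x = y.
Proof.
case: x y => [C hC] [D hD] /= CD; case: _ / CD hD => hD.
by rewrite (Prop_irrelevance hC hD).
Qed.

Lemma VclsP s t : Vcls s = Vcls t <-> veq s t.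
Proof.
split=> [[st]|st]; first by rewrite st; apply: veq_refl.
apply: V_inj => /=; apply/funext => u; apply/propext; split.
  by apply: veq_trans; apply: veq_sym.
exact: veq_trans.
Qed.

Lemma VreprK x : Vcls (Vrepr x) = x.
Proof.
by apply: V_inj; rewrite /Vrepr; case: (cid (svalP x)) => /= s ->.
Qed.

Lemma Vrepr_cls s : veq (Vrepr (Vcls s)) s.
Proof. by apply/VclsP; rewrite VreprK. Qed.

Lemma VclsN s : Vopp (Vcls s) = Vcls (VOpp s).
Proof. exact/VclsP/veq_opp/Vrepr_cls. Qed.

Lemma VclsD s t : Vadd (Vcls s) (Vcls t) = Vcls (VAdd s t).
Proof. by apply/VclsP/veq_add; apply: Vrepr_cls. Qed.

Lemma VaddA x y z : Vadd x (Vadd y z) = Vadd (Vadd x y) z.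
Proof.
rewrite -[x]VreprK -[y]VreprK -[z]VreprK !VclsD.
exact/VclsP/veq_addA.
Qed.

Lemma VaddC x y : Vadd x y = Vadd y x.
Proof. by rewrite -[x]VreprK -[y]VreprK !VclsD; apply/VclsP/veq_addC. Qed.

Lemma Vadd0 x : Vadd V0 x = x.
Proof. by rewrite -[x]VreprK VclsD; apply/VclsP/veq_add0. Qed.

Lemma VaddN x : Vadd (Vopp x) x = V0.
Proof. by rewrite -[x]VreprK VclsN VclsD; apply/VclsP/veq_addN. Qed.

(* The class [P, g, f], set to 0 when (P, g, f) is not a triple of the
   required kind *)
Definition bracket (P : lmodType R) (g f : P -> P -> R^o) : V :=
  match pselect [/\ fg_projective P, alternating_iso g & alternating_iso f] with
  | left (And3 hP hg hf) => Vcls (VGen (Triple hP hg hf))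
  | right _ => V0
  end.

End GroupV.

Arguments bracket {R} P g f.

Section PfaffianKernel.
Variable R : comPzRingType.

(* The homomorphism V(R) -> R^* with [R^2n, g, f] |-> Pf(f) Pf(g)^-1. There is
   exactly one; its values are units because they have the inverses
   phi (Vopp x). *)
Definition is_pfaffian_hom (phi : V R -> R) : Prop :=
  [/\ phi (V0 R) = 1,
      forall x y, phi (Vadd x y) = phi x * phi y &
      forall n (g f : 'rV[R]_(n.*2) -> 'rV[R]_(n.*2) -> R^o),
        alternating_iso g -> alternating_iso f ->
        phi (bracket _ g f) * Pf (gram g) = Pf (gram f)].

Definition Vtilde : V R -> Prop :=
  fun beta => exists2 phi, is_pfaffian_hom phi & phi beta = 1.

End PfaffianKernel.

Section Automorphisms.
Variable R : comPzRingType.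

Definition Aut (M : lmodType R) : set (M -> M) :=
  [set phi | linear phi /\ bijective phi].

Definition Um (M : lmodType R) : set {linear M -> R^o} :=
  [set a | forall r, exists m, a m = r].

(* a H = {a phi : phi \in H} *)
Definition translates (M : lmodType R) (a : M -> R^o) (H : set (M -> M)) :
    set {linear M -> R^o} :=
  [set b | exists2 phi, H phi & forall m, b m = a (phi m)].

(* The subgroup E(M) for M the direct sum of the M_ i, with inclusions inj and
   projections proj *)
Inductive elementary (I : Type) (M_ : I -> lmodType R) (M : lmodType R)
    (inj : forall i, M_ i -> M) (proj : forall i, M -> M_ i) :
    (M -> M) -> Prop :=
  | elementary_id : elementary inj proj id
  | elementary_gen i j (s : {linear M_ j -> M_ i}) : i <> j ->
      elementary inj proj (fun m => m + inj i (s (proj j m)))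
  | elementary_comp f g : elementary inj proj f -> elementary inj proj g ->
      elementary inj proj (f \o g)
  | elementary_inv f g : elementary inj proj f -> cancel f g -> cancel g f ->
      elementary inj proj g.

Variable P0 : lmodType R.

(* P0 (+) R^k; its last k summands are R e_3, ..., R e_(k+2) *)
Fixpoint add_free (k : nat) : lmodType R :=
  if k is k'.+1 then (add_free k' * R^o)%type else P0.

Fixpoint summand_index (k : nat) : Type :=
  if k is k'.+1 then option (summand_index k') else unit.

Fixpoint summand (k : nat) : summand_index k -> lmodType R :=
  match k return summand_index k -> lmodType R with
  | 0 => fun _ => P0
  | k'.+1 => fun i => if i is Some j then summand j else R^o
  end.

Fixpoint summand_inj (k : nat) :
    forall i : summand_index k, summand i -> add_free k :=
  match k return forall i : summand_index k, summand i -> add_free k with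
  | 0 => fun _ x => x
  | k'.+1 => fun i =>
      match i return @summand k'.+1 i -> add_free k'.+1 with
      | Some j => fun x => (@summand_inj k' j x, 0)
      | None => fun r => (0, r)
      end
  end.

Fixpoint summand_proj (k : nat) :
    forall i : summand_index k, add_free k -> summand i :=
  match k return forall i : summand_index k, add_free k -> summand i with
  | 0 => fun _ x => x
  | k'.+1 => fun i =>
      match i return add_free k'.+1 -> @summand k'.+1 i with
      | Some j => fun x => @summand_proj k' j x.1
      | None => fun x => x.2
      end
  end.

Definition E_free (k : nat) : set (add_free k -> add_free k) :=
  elementary (@summand_inj k) (@summand_proj k).

(* phi |-> phi (+) id, iterated m times *)
Fixpoint stabilize (m k : nat) (phi : add_free k -> add_free k) :
    add_free (m + k) -> add_free (m + k) :=
  match m return add_free (m + k) -> add_free (m + k) with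
  | 0 => phi
  | m'.+1 => fun x => (@stabilize m' k phi x.1, x.2)
  end.

Arguments stabilize m {k} phi _.

(* P_n, for n >= 2 *)
Definition P_ (n : nat) : lmodType R := add_free n.-2.

(* The intersection of E_oo(P0) with Aut(P_n): the automorphisms of P_n whose
   image in the colimit Aut_oo(P0) is that of an element of some E(P_m). *)
Definition Einf_Aut (n : nat) : set (P_ n -> P_ n) :=
  [set phi | Aut phi /\ exists m, E_free (stabilize m phi)].

Fixpoint free_coord (j k : nat) : add_free k -> R^o :=
  match k return add_free k -> R^o with
  | 0 => fun _ => 0
  | k'.+1 => fun x => if j == k'.+3 then x.2 else @free_coord j k' x.1
  end.

Arguments free_coord j {k} _.

(* pi_{j,n} : P_n -> R e_j, for 3 <= j <= n *)
Definition pi_ (j n : nat) : P_ n -> R^o := free_coord j (k := n.-2).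

(* chi _|_ psi_2N on P_(2N+2), for chi on P0 *)
Fixpoint perp_psi (N : nat) (chi : P0 -> P0 -> R^o) :
    P_ N.*2.+2 -> P_ N.*2.+2 -> R^o :=
  match N return P_ N.*2.+2 -> P_ N.*2.+2 -> R^o with
  | 0 => chi
  | N'.+1 => perp_psi2 (@perp_psi N' chi)
  end.

End Automorphisms.

Arguments Um {R} M _.
Arguments stabilize {R P0} m {k} phi _.
Arguments E_free {R} P0 k _.
Arguments P_ {R} P0 n.
Arguments Einf_Aut {R} P0 n _.
Arguments free_coord {R} P0 j {k} _.
Arguments pi_ {R} P0 j n _.
Arguments perp_psi {R P0} N chi _ _.

Section Kernel.
Variables (R : comPzRingType) (M : lmodType R) (a : {linear M -> R^o}).

Definition ker_pred : {pred M} := [pred x | a x == 0].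

Lemma ker_pred_closed : submod_closed ker_pred.
Proof.
split=> [|r x y]; rewrite !inE ?linear0 // => /eqP x0 /eqP y0.
by rewrite linearP x0 y0 scaler0 addr0.
Qed.

HB.instance Definition _ := GRing.isSubmodClosed.Build R M ker_pred
  ker_pred_closed.

Record Ker : Type := Kernel {
  kernel_val :> M;
  kernelP : kernel_val \in ker_pred }.

HB.instance Definition _ := [isSub for kernel_val].
HB.instance Definition _ := [Choice of Ker by <:].
HB.instance Definition _ := [SubChoice_isSubLmodule of Ker by <:].

Variables (s : {linear R^o -> M}) (sK : cancel s a).

Lemma kernel_proj_subproof m : m - s (a m) \in ker_pred.
Proof. by rewrite inE linearB sK subrr. Qed.

(* i(p) = (p - s(a(p)), a(p)) *)
Definition kernel_split (m : M) : (Ker * R^o)%type :=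
  (Kernel (kernel_proj_subproof m), a m).

End Kernel.

(* The inverse of a bijection f *)
Definition inv_of (T : choiceType) (U : Type) (t0 : T) (f : T -> U) (u : U) :
  T := xget t0 [set t | f t = u].

Section Symbol.
Variables (R : comPzRingType) (P0 : lmodType R).
Variable theta0 : {linear R^o -> ext P0 2}.

Definition chi0 (p q : P0) : R^o := inv_of 0 theta0 (wedge2 p q).

Local Notation P3 := (P0 * R^o)%type.

Definition incl (p : P0) : P3 := (p, 0).

Lemma incl_linear : linear incl.
Proof. by move=> r x y; congr pair; rewrite /= scaler0 addr0. Qed.

HB.instance Definition _ := GRing.isLinear.Build R P0 P3 *:%R incl incl_linear.

Section Split.
Variables (a : {linear P3 -> R^o}) (s : {linear R^o -> P3}) (sK : cancel s a).

(* det(P0) -> det(P0 (+) R), w |-> w /\ e_3 *)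
Definition det_add : {linear ext P0 2 -> ext P3 3} :=
  wedge_right 2 incl (0, 1).

(* det(P(a)) -> det(P0 (+) R), w |-> w /\ s(1) *)
Definition det_ker : {linear ext (Ker a) 2 -> ext P3 3} :=
  wedge_right 2 (\val : {linear Ker a -> P3}) (s 1).

Definition theta (r : R^o) : ext (Ker a) 2 :=
  inv_of 0 det_ker (det_add (theta0 r)).

Definition chi_ker (p q : Ker a) : R^o := inv_of 0 theta (wedge2 p q).

Definition vaserstein_split : V R :=
  bracket (P3 * R^o)%type (perp_psi2 chi0)
    (pullback (fun x : (P3 * R^o)%type => (kernel_split sK x.1, x.2))
       (perp_psi2 chi_ker)).

End Split.

Lemma Um_section (a : {linear P3 -> R^o}) :
  Um P3 a -> exists s : {linear R^o -> P3}, cancel s a.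
Proof.
move=> /(_ 1)[m am]; pose s (r : R^o) : P3 := r *: m.
have s_lin : linear s by move=> r x y; rewrite /s scalerDl scalerA.
pose sM := GRing.isLinear.Build R R^o P3 *:%R s s_lin.
pose sL : {linear R^o -> P3} := HB.pack s sM.
exists sL => r; rewrite /= /s linearZ /= am.
by rewrite /GRing.scale /= mulr1.
Qed.

(* V(a), computed with an arbitrarily chosen section of a *)
Definition vaserstein (a : {a : {linear P3 -> R^o} | Um P3 a}) : V R :=
  vaserstein_split (svalP (cid (Um_section (svalP a)))).

End Symbol.

(* Main.v *)
Require Import Defs.
From HB Require Import structures.
From mathcomp Require Import all_boot all_order perm all_algebra.
From mathcomp Require Import all_classical.
From mathcomp Require Import ring.

Set Implicit Arguments.
Unset Strict Implicit.
Unset Printing Implicit Defensive.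
Import GRing.Theory.
Local Open Scope classical_set_scope.
Local Open Scope ring_scope.

(* Elementary automorphisms do not change the class of a form in V(R): after
   adding an orthogonal copy of the module they are commutators, and
   phi |-> [M, w, phi^t w phi] is a homomorphism to an abelian group. If chi is
   a form on P_(2n+2) with n > 1, then chi(-, e_(2n+2)) is unimodular on
   P_(2n+1), so by hypothesis an automorphism that is stably elementary turns
   it into the last projection; one more transvection splits off psi_2. This
   brings beta to the form [P_4, chi_0 _|_ psi_2, chi].

   Put a = chi(-, e_4) on P_3. Alternating trilinear maps on P_3 are multiples
   of the volume form (x, y, z) |-> x /\ y /\ z, because P_0 has rank 2. The
   map a /\ chi is one of them, and its coefficient is the Pfaffian of chi
   relative to chi_0 _|_ psi_2, which is 1 since beta is in the kernel of the
   Pfaffian. Hence chi restricts to chi_a on P(a), and beta = V(a).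

   To compare the relative Pfaffian with the combinatorial one, embed
   (P_0, chi_0) isometrically in a hyperbolic space: the Pfaffian of a Gram
   matrix is an alternating multilinear function of the vectors, so it can be
   evaluated with two arguments in P_0, and then the remaining ones may be
   replaced by their components orthogonal to P_0. The same embedding shows
   that every class is of the form [P_(2N+2), chi_0 _|_ psi_2N, chi]. *)

(** * Alternating forms and the group V(R) *)

Section RawLinear.
Variables (R : comPzRingType) (M N : lmodType R).

(** Forms are bare functions, so a proof of linearity has to be bundled before the theory of linear
    maps and [alt_bijective] can be applied. *)
Definition to_linear (f : M -> N) (fl : linear f) : {linear M -> N} :=
  let m := GRing.isLinear.Build R M N *:%R f fl in HB.pack f m.

Variables (f : M -> N) (fl : linear f).

Lemma lin0 : f 0 = 0. Proof. exact: linear0 (to_linear fl). Qed.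
Lemma linD x y : f (x + y) = f x + f y. Proof. exact: linearD (to_linear fl) x y. Qed.
Lemma linN x : f (- x) = - f x. Proof. exact: linearN (to_linear fl) x. Qed.
Lemma linB x y : f (x - y) = f x - f y. Proof. exact: linearB (to_linear fl) x y. Qed.
Lemma linZ a x : f (a *: x) = a *: f x. Proof. exact: (linearZZ (to_linear fl)). Qed.

Lemma can_linear g : cancel f g -> cancel g f -> linear g.
Proof. by move=> fK gK a x y; apply: (can_inj fK); rewrite gK linD linZ !gK. Qed.

End RawLinear.

Section AlternatingBilinear.
Variables (R : comPzRingType) (M N : lmodType R).

Record alt_bilinear (B : M -> M -> N) : Prop := {
  ab_linearl : forall q, linear (B^~ q);
  ab_linearr : forall p, linear (B p);
  ab_alt : forall p, B p p = 0 }.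

Variables (B : M -> M -> N) (hB : alt_bilinear B).

Lemma abDl x y z : B (x + y) z = B x z + B y z.
Proof. exact: (linD (ab_linearl hB z)). Qed.
Lemma abDr x y z : B z (x + y) = B z x + B z y.
Proof. exact: (linD (ab_linearr hB z)). Qed.
Lemma abZl a x z : B (a *: x) z = a *: B x z.
Proof. exact: (linZ (ab_linearl hB z)). Qed.
Lemma abZr a x z : B z (a *: x) = a *: B z x.
Proof. exact: (linZ (ab_linearr hB z)). Qed.
Lemma abNl x z : B (- x) z = - B x z.
Proof. exact: (linN (ab_linearl hB z)). Qed.
Lemma abNr x z : B z (- x) = - B z x.
Proof. exact: (linN (ab_linearr hB z)). Qed.
Lemma ab0l z : B 0 z = 0.
Proof. exact: (lin0 (ab_linearl hB z)). Qed.
Lemma ab0r z : B z 0 = 0.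
Proof. exact: (lin0 (ab_linearr hB z)). Qed.
Lemma abC x y : B x y = - B y x.
Proof.
apply/eqP; rewrite -addr_eq0; apply/eqP.
by have := ab_alt hB (x + y); rewrite abDl !abDr !(ab_alt hB) add0r addr0.
Qed.

End AlternatingBilinear.

Lemma alt_bilinear_pullback (R : comPzRingType) (L M N : lmodType R)
    (h : L -> M) (B : M -> M -> N) :
  linear h -> alt_bilinear B -> alt_bilinear (fun x y => B (h x) (h y)).
Proof.
move=> hl hB; split=> [q a x y|p a x y|p]; last exact: ab_alt.
  by rewrite hl (ab_linearl hB).
by rewrite hl (ab_linearr hB).
Qed.

Section Forms.
Variable R : comPzRingType.
Implicit Types M N P Q : lmodType R.

Lemma alternating_iso_bilinear P (chi : P -> P -> R^o) :
  alternating_iso chi -> alt_bilinear chi.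
Proof. by case. Qed.

(** Both [q] and 0 represent the zero functional, so the uniqueness in [alt_bijective] identifies
    them. *)
Lemma alternating_iso_nondegenerate P (chi : P -> P -> R^o) :
  alternating_iso chi -> forall q, (forall p, chi p q = 0) -> q = 0.
Proof.
move=> hchi q q0; have hB := alternating_iso_bilinear hchi.
have [q' [_ uq]] := alt_bijective hchi (to_linear (ab_linearr hB 0)).
have e p : to_linear (ab_linearr hB 0) p = 0 by rewrite /= (ab0l hB).
by rewrite -(uq q) 1?(uq 0) // => p; rewrite e ?q0 ?(ab0r hB).
Qed.

Lemma alternating_isoI P (chi : P -> P -> R^o) :
  alt_bilinear chi -> (forall q, (forall p, chi p q = 0) -> q = 0) ->
  (forall l : {linear P -> R^o}, exists q, forall p, chi p q = l p) ->
  alternating_iso chi.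
Proof.
move=> hB inj surj; split; try by case: hB.
move=> l; have [q hq] := surj l; exists q; split=> // q' hq'.
apply/eqP; rewrite -subr_eq0; apply/eqP/inj => p.
by rewrite (abDr hB) (abNr hB) hq hq' subrr.
Qed.

Lemma pullback_comp P Q M (h : P -> Q) (k : Q -> M) chi :
  pullback h (pullback k chi : Q -> Q -> R^o) = pullback (k \o h) chi.
Proof. by []. Qed.

Lemma pullback_id P (chi : P -> P -> R^o) : pullback id chi = chi.
Proof. by []. Qed.

Lemma alternating_iso_pullback P Q (h : P -> Q) (chi : Q -> Q -> R^o) :
  linear h -> bijective h -> alternating_iso chi ->
  alternating_iso (pullback h chi).
Proof.
move=> hl [g hK gK] hchi; have hB := alternating_iso_bilinear hchi.
have gl := can_linear hl hK gK.
apply: alternating_isoI; first exact: alt_bilinear_pullback.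
  move=> q q0; rewrite -[q]hK (_ : h q = 0) ?(lin0 gl) //.
  by apply: (alternating_iso_nondegenerate hchi) => p; rewrite -[p]gK; apply: q0.
move=> l; have lg : linear (l \o g) by move=> a x y; rewrite /= gl linearP.
have [q [hq _]] := alt_bijective hchi (to_linear lg).
by exists (g q) => p; rewrite /pullback gK hq /= hK.
Qed.

Lemma alternating_iso_perp P Q (chi : P -> P -> R^o) (xi : Q -> Q -> R^o) :
  alternating_iso chi -> alternating_iso xi -> alternating_iso (perp chi xi).
Proof.
move=> hc hx; have hC := alternating_iso_bilinear hc.
have hX := alternating_iso_bilinear hx.
apply: alternating_isoI.
- split=> [q a x y|p a x y|p]; rewrite /perp /=.
  + by rewrite (ab_linearl hC) (ab_linearl hX) scalerDr addrACA.
  + by rewrite (ab_linearr hC) (ab_linearr hX) scalerDr addrACA.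
  + by rewrite (ab_alt hC) (ab_alt hX) addr0.
- move=> [q1 q2] q0; congr pair.
    apply: (alternating_iso_nondegenerate hc) => p; have := q0 (p, 0).
    by rewrite /perp /= (ab0l hX) addr0.
  apply: (alternating_iso_nondegenerate hx) => p; have := q0 (0, p).
  by rewrite /perp /= (ab0l hC) add0r.
- move=> l.
  have l1l : linear (fun p : P => l (p, 0)).
    move=> a x y; rewrite -linearP; congr (l _).
    by congr pair; rewrite /= scaler0 addr0.
  have l2l : linear (fun q : Q => l (0, q)).
    move=> a x y; rewrite -linearP; congr (l _).
    by congr pair; rewrite /= scaler0 addr0.
  have [q1 [h1 _]] := alt_bijective hc (to_linear l1l).
  have [q2 [h2 _]] := alt_bijective hx (to_linear l2l).
  exists (q1, q2) => -[p1 p2]; rewrite /perp /= h1 h2 /= -linearD.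
  by congr (l _); congr pair; rewrite /= ?addr0 ?add0r.
Qed.

Definition psi2 (x y : (R^o * R^o)%type) : R^o := x.1 * y.2 - x.2 * y.1.

Lemma alternating_iso_psi2 : alternating_iso psi2.
Proof.
apply: alternating_isoI.
- split=> [q a x y|p a x y|p]; rewrite /psi2 /= /GRing.scale /=; ring.
- move=> [q1 q2] q0; congr pair.
    have := q0 (0, -1); rewrite /psi2 /= => <-; ring.
  have := q0 (1, 0); rewrite /psi2 /= => <-; ring.
- move=> l; exists (- l (0, 1), l (1, 0)) => -[p1 p2]; rewrite /psi2 /=.
  have -> : (p1, p2) = p1 *: ((1, 0) : (R^o * R^o)%type) +
                       p2 *: ((0, 1) : (R^o * R^o)%type).
    by congr pair; rewrite /= /GRing.scale /=; ring.
  rewrite linearD !linearZ /= /GRing.scale /=; ring.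
Qed.

(** [perp_psi2] lives on (P (+) R) (+) R and [perp chi psi2] on P (+) (R (+) R); this reassociation
    transfers facts about [perp]. *)
Definition regroup P (x : (P * R^o * R^o)%type) : (P * (R^o * R^o))%type :=
  (x.1.1, (x.1.2, x.2)).

Lemma regroup_linear P : linear (@regroup P).
Proof. by []. Qed.

Lemma regroup_bij P : bijective (@regroup P).
Proof. by exists (fun x => (x.1, x.2.1, x.2.2)) => [[[? ?] ?]|[? [? ?]]]. Qed.

Lemma perp_psi2E P (chi : P -> P -> R^o) :
  perp_psi2 chi = pullback (@regroup P) (perp chi psi2).
Proof. by []. Qed.

Lemma alternating_iso_perp_psi2 P (chi : P -> P -> R^o) :
  alternating_iso chi -> alternating_iso (perp_psi2 chi).
Proof.
move=> h; rewrite perp_psi2E; apply: alternating_iso_pullback.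
- exact: regroup_linear.
- exact: regroup_bij.
- exact: (alternating_iso_perp h alternating_iso_psi2).
Qed.

Lemma inl2_linear P : linear (fun p : P => (p, 0, 0) : (P * R^o * R^o)%type).
Proof. by move=> a x y; congr pair; try congr pair; rewrite /= ?scaler0 ?addr0. Qed.

(** A functional on [P], extended by zero to the sum, is represented by a pair; the first component
    of that pair represents it on [P]. *)
Lemma alternating_iso_perpl P Q (chi : P -> P -> R^o) (xi : Q -> Q -> R^o) :
  alt_bilinear xi -> alternating_iso (perp chi xi) -> alternating_iso chi.
Proof.
move=> hX h; have hB := alternating_iso_bilinear h.
have e p q : chi p q = perp chi xi (p, 0) (q, 0).
  by rewrite /perp /= (ab0r hX) addr0.
have il : linear (fun p : P => (p, 0) : (P * Q)%type).
  by move=> a x y; congr pair; rewrite /= scaler0 addr0.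
have hC : alt_bilinear chi.
  have := alt_bilinear_pullback il hB.
  by congr alt_bilinear; do 2![apply/funext => ?]; rewrite -e.
apply: alternating_isoI => //.
  move=> q q0; suff [] : (q, 0) = 0 :> (P * Q)%type by [].
  by apply: (alternating_iso_nondegenerate h) => -[p r]; rewrite /perp /= q0 (ab0r hX) addr0.
move=> l; have l' : linear (fun x : (P * Q)%type => l x.1).
  by move=> a x y; rewrite /= linearP.
have [[q r] [hq _]] := alt_bijective h (to_linear l').
by exists q => p; have := hq (p, 0); rewrite /perp /= (ab0l hX) addr0.
Qed.

Lemma alternating_iso_perp_psi2_inv P (chi : P -> P -> R^o) :
  alternating_iso (perp_psi2 chi) -> alternating_iso chi.
Proof.
pose k (x : (P * (R^o * R^o))%type) : (P * R^o * R^o)%type :=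
  (x.1, x.2.1, x.2.2).
have kl : linear k by [].
have kb : bijective k by exists (@regroup P) => [[? [? ?]]|[[? ?] ?]].
move=> /(alternating_iso_pullback kl kb).
exact: (alternating_iso_perpl (alternating_iso_bilinear alternating_iso_psi2)).
Qed.

End Forms.

Section FgProjective.
Variable R : comPzRingType.
Implicit Types P Q : lmodType R.

Lemma fg_projective_rV n : fg_projective 'rV[R]_n.
Proof. by exists n, (@idfun _), (@idfun _). Qed.

Lemma fg_projective_iso P Q (h : {linear P -> Q}) (g : {linear Q -> P}) :
  cancel g h -> fg_projective P -> fg_projective Q.
Proof.
move=> gK [n [p [s sK]]]; exists n, (h \o p), (s \o g) => x /=.
by rewrite sK gK.
Qed.

Lemma fg_projective_prod P Q :
  fg_projective P -> fg_projective Q -> fg_projective (P * Q)%type.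
Proof.
move=> [m [p [s sK]]] [n [p' [s' sK']]].
have pl : linear (fun v : 'rV[R]_(m + n) => (p (lsubmx v), p' (rsubmx v))).
  by move=> a x y; rewrite !linearP.
have sl : linear (fun x : (P * Q)%type => row_mx (s x.1) (s' x.2)).
  by move=> a x y; rewrite /= !linearP /= scale_row_mx add_row_mx.
exists (m + n)%N, (to_linear pl), (to_linear sl) => -[x y] /=.
by rewrite row_mxKl row_mxKr sK sK'.
Qed.

Lemma fg_projective_regular : fg_projective R^o.
Proof.
have pl : linear (fun v : 'rV[R]_1 => v 0 0 : R^o) by move=> a x y; rewrite !mxE.
have sl : linear (fun x : R^o => const_mx x : 'rV[R]_1).
  by move=> a x y; apply/matrixP => i j; rewrite !mxE.
by exists 1%N, (to_linear pl), (to_linear sl) => x /=; rewrite mxE.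
Qed.

Lemma fg_projective_add_free P k : fg_projective P -> fg_projective (add_free P k).
Proof.
by move=> hP; elim: k => //= k IH; apply: fg_projective_prod IH fg_projective_regular.
Qed.

Lemma fg_projective_separated P (x : P) :
  fg_projective P -> (forall l : {linear P -> R^o}, l x = 0) -> x = 0.
Proof.
move=> [n [p [s sK]]] h; rewrite -[x]sK (_ : s x = 0) ?linear0 //.
apply/rowP => i; rewrite mxE.
have li : linear (fun y => s y 0 i : R^o) by move=> a y z; rewrite linearP !mxE.
exact: (h (to_linear li)).
Qed.

End FgProjective.

Section Brackets.
Variable R : comPzRingType.
Implicit Types P Q : lmodType R.
Implicit Types x y z : V R.

Lemma Vaddx0 x : Vadd x (V0 R) = x.
Proof. by rewrite VaddC Vadd0. Qed.

Lemma Vopp0 : Vopp (V0 R) = V0 R.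
Proof. by rewrite -[LHS]Vaddx0 VaddN. Qed.

Lemma Vadd_inj x y z : Vadd x y = Vadd x z -> y = z.
Proof.
by move=> e; rewrite -[y]Vadd0 -(VaddN x) -VaddA e VaddA VaddN Vadd0.
Qed.

Lemma Vadd_swap a b c d :
  Vadd (Vadd (Vadd a b) c) d = Vadd (Vadd a c) (Vadd b d) :> V R.
Proof. by rewrite -[Vadd (Vadd a b) c]VaddA (VaddC b c) !VaddA. Qed.

(** [bracket] decides whether its arguments form a triple; by proof irrelevance the class does not
    depend on the witnesses. *)
Lemma bracketE P (g f : P -> P -> R^o) pP gP fP :
  bracket P g f = Vcls (VGen (@Triple R P g f pP gP fP)).
Proof.
rewrite /bracket; case: pselect => [[p1 g1 f1]|[]] //.
by rewrite (Prop_irrelevance p1 pP) (Prop_irrelevance g1 gP)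
           (Prop_irrelevance f1 fP).
Qed.

Section OneModule.
Variables (P : lmodType R) (pP : fg_projective P).
Implicit Types f g : P -> P -> R^o.

Lemma bracket_comp f0 f1 f2 :
  alternating_iso f0 -> alternating_iso f1 -> alternating_iso f2 ->
  Vadd (bracket P f0 f1) (bracket P f1 f2) = bracket P f0 f2.
Proof.
by move=> h0 h1 h2; rewrite !bracketE VclsD; apply/VclsP/veq_comp.
Qed.

(** The composition relation gives [g, g] + [g, g] = [g, g]. *)
Lemma bracket_self g : alternating_iso g -> bracket P g g = V0 R.
Proof.
by move=> hg; apply: (@Vadd_inj (bracket P g g)); rewrite bracket_comp ?Vaddx0.
Qed.

Lemma bracket_eqr g f f' :
  alternating_iso g -> alternating_iso f -> alternating_iso f' ->
  bracket P f f' = V0 R -> bracket P g f = bracket P g f'.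
Proof. by move=> hg hf hf' e; rewrite -(bracket_comp hg hf hf') e Vaddx0. Qed.

Lemma bracket_opp g f :
  alternating_iso g -> alternating_iso f ->
  Vopp (bracket P g f) = bracket P f g.
Proof.
move=> hg hf; apply: (@Vadd_inj (bracket P g f)).
by rewrite bracket_comp // bracket_self // VaddC VaddN.
Qed.

End OneModule.

Lemma bracket_pullback P Q (h : P -> Q) g f :
  fg_projective P -> fg_projective Q -> linear h -> bijective h ->
  alternating_iso g -> alternating_iso f ->
  bracket P (pullback h g) (pullback h f) = bracket Q g f.
Proof.
move=> pP pQ hl hb hg hf.
have hg' := alternating_iso_pullback hl hb hg.
have hf' := alternating_iso_pullback hl hb hf.
by rewrite !bracketE; apply/VclsP/(@veq_isometry _ _ _ (to_linear hl)).
Qed.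

Lemma bracket_perp P Q (g f : P -> P -> R^o) (g' f' : Q -> Q -> R^o) :
  fg_projective P -> fg_projective Q ->
  alternating_iso g -> alternating_iso f ->
  alternating_iso g' -> alternating_iso f' ->
  bracket (P * Q)%type (perp g g') (perp f f') =
  Vadd (bracket P g f) (bracket Q g' f').
Proof.
move=> pP pQ hg hf hg' hf'.
have hgg := alternating_iso_perp hg hg'; have hff := alternating_iso_perp hf hf'.
have pPQ := fg_projective_prod pP pQ.
by rewrite !bracketE VclsD; apply/VclsP/veq_perp.
Qed.

Lemma bracket_perp_psi2 P (g f : P -> P -> R^o) :
  fg_projective P -> alternating_iso g -> alternating_iso f ->
  bracket (P * R^o * R^o)%type (perp_psi2 g) (perp_psi2 f) = bracket P g f.
Proof.
move=> pP hg hf; have p1 := fg_projective_regular R.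
have p2 := fg_projective_prod p1 p1.
have h2 := alternating_iso_psi2 R.
rewrite !perp_psi2E bracket_pullback.
- by rewrite bracket_perp // (bracket_self p2 h2) Vaddx0.
- by do 2!apply: fg_projective_prod => //.
- exact: fg_projective_prod.
- exact: regroup_linear.
- exact: regroup_bij.
- exact: alternating_iso_perp.
- exact: alternating_iso_perp.
Qed.

(** Zero is the class of (psi_2, psi_2), a negative exchanges the two forms, and a sum is the class
    of an orthogonal sum. *)
Lemma V_generator x : (exists P (g f : P -> P -> R^o), [/\ fg_projective P,
  alternating_iso g, alternating_iso f & x = bracket P g f]).
Proof.
rewrite -[x]VreprK; elim: (Vrepr x) => [[P g f pP hg hf]||s IH|s IHs t IHt].
- by exists P, g, f; split=> //; rewrite bracketE.
- have p1 := fg_projective_regular R; have p2 := fg_projective_prod p1 p1.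
  have h2 := alternating_iso_psi2 R.
  exists (R^o * R^o)%type, (@psi2 R), (@psi2 R); split=> //.
  by rewrite bracket_self.
- have [P [g [f [pP hg hf e]]]] := IH.
  by exists P, f, g; split=> //; rewrite -VclsN e bracket_opp.
- have [P [g [f [pP hg hf e]]]] := IHs.
  have [Q [g' [f' [pQ hg' hf' e']]]] := IHt.
  exists (P * Q)%type, (perp g g'), (perp f f').
  split; [exact: fg_projective_prod | exact: alternating_iso_perp..|].
  by rewrite bracket_perp // -e -e' VclsD.
Qed.

End Brackets.

(** * Automorphisms that do not change classes in V(R) *)

Section Automorphisms.
Variable R : comPzRingType.
Implicit Types M N : lmodType R.

(** The composition relation is applied through [pullback b w]; the isometry [b] carries
    [b^t w, b^t a^t w] to [w, a^t w]. *)
Lemma bracket_pullback_comp M (w : M -> M -> R^o) (a b : M -> M) :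
  fg_projective M -> alternating_iso w -> Aut a -> Aut b ->
  bracket M w (pullback (a \o b) w) =
  Vadd (bracket M w (pullback a w)) (bracket M w (pullback b w)).
Proof.
move=> pM hw [al ab] [bl bb].
have hb := alternating_iso_pullback bl bb hw.
have ha := alternating_iso_pullback al ab hw.
rewrite -(bracket_comp pM hw hb (alternating_iso_pullback bl bb ha)).
by rewrite VaddC bracket_pullback.
Qed.

Lemma Aut_comp M (a b : M -> M) : Aut a -> Aut b -> Aut (a \o b).
Proof.
move=> [al ab] [bl bb]; split; last exact: bij_comp.
by move=> r x y; rewrite /= bl al.
Qed.

Lemma Aut_inv M (a b : M -> M) : cancel a b -> cancel b a -> Aut a -> Aut b.
Proof.
by move=> aK bK [al _]; split; [exact: (can_linear al aK bK) | exists a].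
Qed.

Lemma Aut_transvection M (nu : M -> M) :
  linear nu -> (forall x, nu (nu x) = 0) -> Aut (fun x => x + nu x).
Proof.
move=> nl nn; split; first by move=> r x y; rewrite nl scalerDr addrACA.
exists (fun x => x - nu x) => x; first by rewrite (linD nl) nn addr0 addrK.
by rewrite (linB nl) nn subr0 subrK.
Qed.

(* On M (+) M, the automorphism (id + nu) (+) id is the commutator of the
   elementary automorphisms given by nu and e. *)
Lemma bracket_transvection M (w : M -> M -> R^o) (nu e : M -> M) :
  fg_projective M -> alternating_iso w -> linear nu -> linear e ->
  nu \o e =1 nu -> (forall x, e (nu x) = 0) ->
  bracket M w (pullback (fun x => x + nu x) w) = V0 R.
Proof.
move=> pM hw nl el ne en.
have nn x : nu (nu x) = 0 by rewrite -ne /= en (lin0 nl).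
have tA := Aut_transvection nl nn.
pose A (x : (M * M)%type) : (M * M)%type := (x.1 + nu x.2, x.2).
pose A' (x : (M * M)%type) : (M * M)%type := (x.1 - nu x.2, x.2).
pose B (x : (M * M)%type) : (M * M)%type := (x.1, x.2 + e x.1).
pose B' (x : (M * M)%type) : (M * M)%type := (x.1, x.2 - e x.1).
have AK : cancel A A' by move=> [x y]; rewrite /A /A' /= addrK.
have A'K : cancel A' A by move=> [x y]; rewrite /A /A' /= subrK.
have BK : cancel B B' by move=> [x y]; rewrite /B /B' /= addrK.
have B'K : cancel B' B by move=> [x y]; rewrite /B /B' /= subrK.
have hA : Aut A.
  split; last by exists A'.
  by move=> r [x y] [x' y']; rewrite /A /= nl; congr pair; rewrite /= scalerDr addrACA.
have hB : Aut B.
  split; last by exists B'.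
  by move=> r [x y] [x' y']; rewrite /B /= el; congr pair; rewrite /= scalerDr addrACA.
have hA' := Aut_inv AK A'K hA; have hB' := Aut_inv BK B'K hB.
have hww := alternating_iso_perp hw hw; have pMM := fg_projective_prod pM pM.
have key : A \o B \o A' \o B' = fun x => (x.1 + nu x.1, x.2).
  apply/funext => -[x y]; rewrite /A /B /A' /B' /=.
  have e1 t : e (x - nu t) = e x by rewrite (linB el) en subr0.
  have e2 : nu (e x) = nu x by apply: ne.
  by rewrite e1 subrK (linB nl) e2 opprB addrA addrNK.
have := bracket_perp pM pM hw (alternating_iso_pullback tA.1 tA.2 hw) hw hw.
rewrite (bracket_self pM hw) Vaddx0 => <-.
have -> : perp (pullback (fun x => x + nu x) w) w =
    pullback (A \o B \o A' \o B') (perp w w) by rewrite key.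
have hAB := Aut_comp hA hB; have hABA := Aut_comp hAB hA'.
(* The class is additive in the automorphism and V(R) is abelian, so the factors regroup as
   [A \o A'] and [B \o B'], both the identity. *)
rewrite (bracket_pullback_comp pMM hww hABA hB').
rewrite (bracket_pullback_comp pMM hww hAB hA').
rewrite (bracket_pullback_comp pMM hww hA hB) Vadd_swap.
rewrite -(bracket_pullback_comp pMM hww hA hA').
rewrite -(bracket_pullback_comp pMM hww hB hB').
have -> : A \o A' = id by apply/funext => x /=; rewrite A'K.
have -> : B \o B' = id by apply/funext => x /=; rewrite B'K.
by rewrite !pullback_id bracket_self // Vadd0.
Qed.

Definition with_id M N (a : M -> M) (x : (M * N)%type) : (M * N)%type :=
  (a x.1, x.2).

Lemma Aut_with_id M N (a : M -> M) : Aut a -> Aut (@with_id M N a).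
Proof.
move=> [al [b aK bK]]; split; first by move=> r x y; rewrite /with_id /= al.
by exists (@with_id M N b) => -[x y]; rewrite /with_id /= ?aK ?bK.
Qed.

(** The complement [N] and the form on the sum are arbitrary, so that further summands can be
    absorbed into [N] when passing from phi (+) id back to phi. *)
Definition stably_trivial M (a : M -> M) : Prop :=
  forall N (w : (M * N)%type -> (M * N)%type -> R^o),
    fg_projective N -> alternating_iso w ->
    bracket (M * N)%type w (pullback (@with_id M N a) w) = V0 R.

(** Adding psi_2 does not change the class. Of its two lines, both fixed by the automorphism, one
    joins [M] and the other joins [N]. *)
Lemma stably_trivial_destabilize M (a : M -> M) :
  fg_projective M -> Aut a ->
  stably_trivial (@with_id M R^o a) -> stably_trivial a.
Proof.
move=> pM aA st N w pN hw.
have p1 := fg_projective_regular R.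
have pMN := fg_projective_prod pM pN.
have h2 := alternating_iso_perp_psi2 hw.
have wA := Aut_with_id N aA.
rewrite -(bracket_perp_psi2 pMN hw (alternating_iso_pullback wA.1 wA.2 hw)).
pose h (x : (M * N * R^o * R^o)%type) : (M * R^o * (N * R^o))%type :=
  (x.1.1.1, x.1.2, (x.1.1.2, x.2)).
pose k (x : (M * R^o * (N * R^o))%type) : (M * N * R^o * R^o)%type :=
  (x.1.1, x.2.1, x.1.2, x.2.2).
have hK : cancel h k by case=> [[[]]].
have kK : cancel k h by case=> [[] ? ? []].
have hl : linear h by [].
have kl : linear k by [].
have hb : bijective h by exists k.
have kb : bijective k by exists h.
have hw' := alternating_iso_pullback kl kb h2.
have pN' := fg_projective_prod pN p1.
have := st _ _ pN' hw'; set w' := pullback k _.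
have wwA := Aut_with_id (N * R^o)%type (Aut_with_id R^o aA).
rewrite -(bracket_pullback _ _ hl hb) //; first last.
- exact: (alternating_iso_pullback wwA.1 wwA.2 hw').
- by do !apply: fg_projective_prod.
- by do !apply: fg_projective_prod.
by move=> <-; congr bracket; rewrite /w' pullback_comp; apply/funext => -[[[? ?] ?] ?];
  apply/funext => -[[[? ?] ?] ?].
Qed.

(** A generator is id + nu with nu of square zero; the projector [e] onto its source summand is the
    other ingredient of the commutator in [bracket_transvection]. Products follow from additivity,
    inverses by exchanging the two forms. *)
Lemma elementary_stably_trivial (I : Type) (M_ : I -> lmodType R) M
    (inj : forall i, M_ i -> M) (proj : forall i, M -> M_ i) (f : M -> M) :
  fg_projective M -> (forall i, linear (inj i)) -> (forall i, linear (proj i)) ->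
  (forall i, cancel (inj i) (proj i)) ->
  (forall i j, i <> j -> forall x, proj j (inj i x) = 0) ->
  elementary inj proj f -> Aut f /\ stably_trivial f.
Proof.
move=> pM il pl ipK ip0; elim=> {f} [|i j s nij|f g _ [fA fS] _ [gA gS]|f g _ [fA fS] fK gK].
- split; first by split=> //; exists id.
  move=> N w pN hw; have pMN := fg_projective_prod pM pN.
  have -> : @with_id M N id = id by apply/funext => -[].
  by rewrite pullback_id bracket_self.
- pose nu m := inj i (s (proj j m)); pose e m := inj j (proj j m).
  have nl : linear nu by move=> r x y; rewrite /nu pl linearP il.
  have el : linear e by move=> r x y; rewrite /e pl il.
  have ne x : nu (e x) = nu x by rewrite /nu /e ipK.
  have en x : e (nu x) = 0 by rewrite /nu /e ip0 // (lin0 (il j)).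
  have nn x : nu (nu x) = 0 by rewrite -ne en (lin0 nl).
  split; first exact: Aut_transvection nl nn.
  move=> N w pN hw; have pMN := fg_projective_prod pM pN.
  pose nu' (x : (M * N)%type) : (M * N)%type := (nu x.1, 0).
  pose e' (x : (M * N)%type) : (M * N)%type := (e x.1, 0).
  have nl' : linear nu'.
    by move=> r x y; rewrite /nu' /= nl; congr pair; rewrite /= scaler0 addr0.
  have el' : linear e'.
    by move=> r x y; rewrite /e' /= el; congr pair; rewrite /= scaler0 addr0.
  have ne' : nu' \o e' =1 nu' by move=> x; rewrite /nu' /e' /= ne.
  have en' x : e' (nu' x) = 0 by rewrite /nu' /e' /= en.
  have -> : @with_id M N (fun m => m + inj i (s (proj j m))) = fun x => x + nu' x.
    apply/funext => -[x y].
    by rewrite /with_id /nu' /=; congr pair; rewrite /= addr0.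
  exact: (bracket_transvection pMN hw nl' el' ne' en').
- split; first exact: Aut_comp.
  move=> N w pN hw; have pMN := fg_projective_prod pM pN.
  have -> : @with_id M N (f \o g) = @with_id M N f \o @with_id M N g by [].
  rewrite bracket_pullback_comp //; try exact: Aut_with_id.
  by rewrite fS // gS // Vadd0.
- have gA := Aut_inv fK gK fA; split=> //.
  move=> N w pN hw; have pMN := fg_projective_prod pM pN.
  have gwA := Aut_with_id N gA.
  have hw' := alternating_iso_pullback gwA.1 gwA.2 hw.
  rewrite -bracket_opp //.
  have {2}-> : w = pullback (@with_id M N f) (pullback (@with_id M N g) w).
    by rewrite pullback_comp; apply/funext => -[x y]; apply/funext => -[x' y'];
      rewrite /pullback /with_id /= !fK.
  by rewrite fS // Vopp0.
Qed.

End Automorphisms.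

(** * Pfaffians of lists of vectors *)

Section AlternatingList.
Variables (R : comPzRingType) (M : lmodType R).
Implicit Types (f : seq M -> R^o) (l : seq M).

(** The function takes lists of every length, so that entries can be deleted or prepended without
    changing its type. Vanishing is asked for adjacent equal entries; [al_rep] extends it. *)
Record alt_list f : Prop := {
  al_linear : forall l1 l2, linear (fun x => f (l1 ++ x :: l2));
  al_alt : forall l1 x l2, f (l1 ++ x :: x :: l2) = 0 }.

Lemma alt_list_cons f x : alt_list f -> alt_list (fun l => f (x :: l)).
Proof.
move=> [fl fa]; split=> [l1 l2|l1 y l2]; first exact: (fl (x :: l1)).
exact: (fa (x :: l1)).
Qed.

Lemma al_swap f (hf : alt_list f) l1 x y l2 : f (l1 ++ x :: y :: l2) = - f (l1 ++ y :: x :: l2).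
Proof.
have h1 a b c := linD (al_linear hf l1 (c :: l2)) a b.
have h2 c a b : f (l1 ++ c :: (a + b) :: l2) =
    f (l1 ++ c :: a :: l2) + f (l1 ++ c :: b :: l2).
  by have := linD (al_linear hf (l1 ++ [:: c]) l2) a b; rewrite -!catA.
have := al_alt hf l1 (x + y) l2.
rewrite h1 !h2 !(al_alt hf) add0r addr0 => /eqP.
by rewrite addr_eq0 => /eqP.
Qed.

Lemma al_move f (hf : alt_list f) l1 x l2 : f (l1 ++ x :: l2) = (-1) ^+ size l1 * f (x :: l1 ++ l2).
Proof.
elim/last_ind: l1 l2 => [|l1 y IH] l2; first by rewrite mul1r.
rewrite cat_rcons (al_swap hf) IH size_rcons exprS mulN1r mulNr; congr (- (_ * f _)).
by rewrite cat_rcons.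
Qed.

Lemma al_rep f (hf : alt_list f) l1 x l2 l3 : f (l1 ++ x :: l2 ++ x :: l3) = 0.
Proof.
rewrite (al_move hf) catA (al_move (alt_list_cons x hf)).
by rewrite (al_alt hf [::]) !mulr0.
Qed.

(** Each of the two entries crosses all of [l1], so the signs cancel. *)
Lemma al_move2 f (hf : alt_list f) l1 x y l2 :
  f (l1 ++ x :: y :: l2) = f (x :: y :: l1 ++ l2).
Proof.
rewrite (al_move hf) (al_move (alt_list_cons x hf)) mulrA.
by rewrite -expr2 sqrr_sign mul1r.
Qed.

End AlternatingList.

Lemma alt_list_map (R : comPzRingType) (M N : lmodType R) (g : seq N -> R^o) (h : M -> N) :
  linear h -> alt_list g -> alt_list (fun l => g (map h l)).
Proof.
move=> hl [gl ga]; split=> [l1 l2 a x y|l1 y l2]; rewrite !map_cat /=.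
  by rewrite hl gl.
exact: ga.
Qed.


Section ListPfaffian.
Variables (R : comPzRingType) (M : lmodType R) (chi : M -> M -> R^o).
Implicit Types (f : seq M -> R^o) (l : seq M).

(* Interior product with chi x: the alternating sum over j of chi x l_j times
   f evaluated at l with its j-th entry deleted. *)
Fixpoint contract (x : M) f l : R^o :=
  if l is y :: l' then chi x y * f l' - contract x (fun t => f (y :: t)) l'
  else 0.

(* The Pfaffian of the Gram matrix of a list of 2n vectors *)
Fixpoint pf (n : nat) (l : seq M) : R^o :=
  if n is n'.+1 then if l is x :: l' then contract x (pf n') l' else 0
  else (nilp l)%:R.

Lemma contract_lin x f g a l :
  contract x (fun t => a * f t + g t) l = a * contract x f l + contract x g l.
Proof.
by elim: l f g => [|y l IH] f g /=; rewrite ?IH; ring.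
Qed.

Lemma contract0 x l : contract x (fun=> 0) l = 0.
Proof. by elim: l => //= y l ->; ring. Qed.

(** Each pair of entries is deleted twice, in the two orders, with opposite signs. *)
Lemma contract_sq x f l : contract x (contract x f) l = 0.
Proof.
elim: l f => [|z l IH] f //=.
have -> : (fun t => chi x z * f t - contract x (fun s => f (z :: s)) t) =
          (fun t => -1 * contract x (fun s => f (z :: s)) t + (chi x z * f t + 0)).
  by apply/funext => t; ring.
rewrite contract_lin IH contract_lin contract0; ring.
Qed.

Lemma contract_orth x f l : {in l, forall y, chi x y = 0} -> contract x f l = 0.
Proof.
elim: l f => [|y l IH] f h //=; rewrite h ?mem_head // mul0r IH ?subr0 // => z zl.
by apply: h; rewrite inE zl orbT.
Qed.

Lemma pf_head2 n x y l : {in l, forall z, chi x z = 0} ->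
  pf n.+1 (x :: y :: l) = chi x y * pf n l.
Proof. by move=> h /=; rewrite contract_orth // subr0. Qed.

(** No entry of [l] can be matched with [x1], [x2] or [x3], so the first four vectors are matched
    among themselves and their 4 x 4 Pfaffian splits off. *)
Lemma pf_head4 n x1 x2 x3 x4 l :
  {in l, forall z, chi x1 z = 0} -> {in l, forall z, chi x2 z = 0} ->
  {in l, forall z, chi x3 z = 0} ->
  pf n.+2 (x1 :: x2 :: x3 :: x4 :: l) =
  (chi x1 x2 * chi x3 x4 - chi x1 x3 * chi x2 x4 + chi x1 x4 * chi x2 x3)
    * pf n l.
Proof. by move=> h1 h2 h3 /=; rewrite !contract_orth //; ring. Qed.

Hypothesis hchi : alt_bilinear chi.

Lemma contract_linear f l : linear (fun x => contract x f l).
Proof.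
move=> a x y; elim: l f => [|z l IH] f /=; first by rewrite scaler0 addr0.
by rewrite IH (ab_linearl hchi) /GRing.scale /=; ring.
Qed.

Lemma alt_list_contract x f : alt_list f -> alt_list (contract x f).
Proof.
move=> hf; split.
  move=> l1; elim: l1 f hf => [|z l1 IH] f hf l2 a y y' /=.
    rewrite (ab_linearr hchi).
    have -> : (fun t => f ((a *: y + y') :: t)) =
              (fun t => a * f (y :: t) + f (y' :: t)).
      by apply/funext => t; apply: (al_linear hf [::]).
    by rewrite contract_lin /GRing.scale /=; ring.
  rewrite (al_linear hf) (IH _ (alt_list_cons z hf)) /GRing.scale /=; ring.
move=> l1; elim: l1 f hf => [|z l1 IH] f hf y l2 /=.
  have -> : (fun t => f (y :: y :: t)) = fun=> 0.
    by apply/funext => t; apply: (al_alt hf [::]).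
  rewrite contract0; ring.
by rewrite (al_alt hf) (IH _ (alt_list_cons z hf)); ring.
Qed.

Lemma alt_list_pf n : alt_list (pf n).
Proof.
elim: n => [|n IH].
  by split=> [[|z l1] l2 a x y|[|z l1] x l2] //=; rewrite scaler0 addr0.
have hc x := alt_list_contract x IH; split=> [[|z l1] l2|[|z l1] x l2] /=.
- exact: contract_linear.
- exact: (al_linear (hc z)).
- rewrite (ab_alt hchi) mul0r sub0r; apply/eqP; rewrite oppr_eq0; apply/eqP.
  (* What remains is a double contraction with [x]; for n = 0 it vanishes because [pf 0] is zero on
     non-empty lists. *)
  case: n {IH hc} => [|n] /=; last exact: contract_sq.
  by rewrite (_ : (fun _ => _) = fun=> 0) ?contract0 //; apply/funext.
- exact: (al_alt (hc z)).
Qed.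

(** This unfolds the recursion into the expansion of a Pfaffian along its first row; [lift j] skips
    the deleted index. *)
Lemma contract_enum x f m (v : 'I_m.+1 -> M) :
  contract x f [seq v i | i <- enum 'I_m.+1] =
  \sum_(j < m.+1) (-1) ^+ j * chi x (v j) *
     f [seq v (lift j i) | i <- enum 'I_m].
Proof.
elim: m f v => [|m IH] f v.
  rewrite big_ord_recl big_ord0 enum_ordSl /= enum_ord0 /=; ring.
rewrite enum_ordSl /= -map_comp (IH _ (v \o lift ord0)) [RHS]big_ord_recl /=.
rewrite expr0 mul1r; congr (_ + _); rewrite -sumrN; apply: eq_bigr => j _.
rewrite [in RHS]enum_ordSl /= -map_comp /bump add1n exprS mulN1r !mulNr; congr (- (_ * f (_ :: _))).
  by congr v; apply: val_inj.
by apply: eq_map => i /=; congr v; apply: val_inj; rewrite /= /bump !add1n ltnS addnS.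
Qed.

End ListPfaffian.

Lemma contract_map (R : comPzRingType) (M N : lmodType R)
    (chi : N -> N -> R^o) (h : M -> N) x f l :
  contract chi (h x) f (map h l) =
  contract (pullback h chi) x (fun t => f (map h t)) l.
Proof. by elim: l f => //= y l IH f; rewrite IH. Qed.

Lemma pf_map (R : comPzRingType) (M N : lmodType R)
    (chi : N -> N -> R^o) (h : M -> N) n l :
  pf chi n (map h l) = pf (pullback h chi) n l.
Proof.
elim: n l => [|n IH] [|x l] //=; rewrite contract_map.
by congr contract; apply/funext.
Qed.

(** * Agreement of the combinatorial and the recursive Pfaffian *)

Section PfaffianExpansion.

Lemma lift_perm_exists n (i j : 'I_n.+1) (s : 'S_n.+1) :
  s i = j -> exists t, s = lift_perm i j t.
Proof.
move=> sij; pose t k := odflt k (unlift j (s (lift i k))).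
have tE k : lift j (t k) = s (lift i k).
  rewrite /t; case: unliftP => // e; have := neq_lift i k.
  by rewrite -(inj_eq (@perm_inj _ s)) sij e eqxx.
have t_inj : injective t.
  by move=> k k' e; apply: (@lift_inj _ i); apply: (@perm_inj _ s); rewrite -!tE e.
exists (perm t_inj); apply/permP => k.
by case: (unliftP i k) => [k'|] ->; rewrite ?lift_perm_id // lift_perm_lift permE tE.
Qed.

Lemma lift_perm_inj n (i j : 'I_n.+1) : injective (lift_perm i j).
Proof.
move=> s t e; apply/permP => k; apply: (@lift_inj _ j).
by rewrite -!(lift_perm_lift i) e.
Qed.

Lemma big_lift_perm (R : nmodType) n (i j : 'I_n.+1) (P : pred 'S_n.+1)
    (F : 'S_n.+1 -> R) :
  \sum_(s | P s && (s i == j)) F s =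
  \sum_(t | P (lift_perm i j t)) F (lift_perm i j t).
Proof.
rewrite -(big_imset _ (in2W (@lift_perm_inj n i j))) /=.
apply: eq_bigl => s; apply/andP/imsetP => [[Ps /eqP /lift_perm_exists [t e]]|[t Pt ->]].
  by exists t; rewrite // unfold_in /= -e.
by rewrite lift_perm_id eqxx.
Qed.

Lemma even_ord0 n : even_ord (@ord0 n) = ord0 :> 'I_n.*2.+2.
Proof. exact: val_inj. Qed.

Lemma odd_ord0 n : odd_ord (@ord0 n) = lift ord0 ord0 :> 'I_n.*2.+2.
Proof. exact: val_inj. Qed.

Lemma even_ordS n (i : 'I_n) :
  even_ord (lift ord0 i) = lift ord0 (lift ord0 (even_ord i)) :> 'I_n.*2.+2.
Proof. exact: val_inj. Qed.

Lemma odd_ordS n (i : 'I_n) :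
  odd_ord (lift ord0 i) = lift ord0 (lift ord0 (odd_ord i)) :> 'I_n.*2.+2.
Proof. exact: val_inj. Qed.

Definition ord_splitE := (even_ord0, odd_ord0, even_ordS, odd_ordS).

Lemma ltn_lift n (j : 'I_n.+1) (a b : 'I_n) : (lift j a < lift j b)%N = (a < b)%N.
Proof. by rewrite /= !ltnNge leq_bump2. Qed.

(** The first pair becomes {0, j + 1}, which is in normal order whatever [j] is; [lift] is
    increasing, so the other conditions are those on [t]. *)
Lemma matching_lift n (j : 'I_n.*2.+1) (t : 'S_n.*2) :
  @matching n.+1 (lift_perm ord0 ord0 (lift_perm ord0 j t)) = matching t.
Proof.
set s := lift_perm _ _ _.
have s0 : s (even_ord (@ord0 n)) = ord0 by rewrite even_ord0 lift_perm_id.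
have s1 : s (odd_ord (@ord0 n)) = lift ord0 j.
  by rewrite odd_ord0 lift_perm_lift lift_perm_id.
have se i : s (even_ord (lift ord0 i)) = lift ord0 (lift j (t (even_ord i))).
  by rewrite even_ordS !lift_perm_lift.
have so i : s (odd_ord (lift ord0 i)) = lift ord0 (lift j (t (odd_ord i))).
  by rewrite odd_ordS !lift_perm_lift.
rewrite /matching; congr (_ && _); apply/forallP/forallP => h.
- by move=> i; have := h (lift ord0 i); rewrite se so !ltn_lift.
- move=> i; case: (unliftP ord0 i) => [k|] ->; last by rewrite s0 s1.
  by rewrite se so !ltn_lift.
- move=> i; apply/forallP => k; have /forallP/(_ (lift ord0 k)) := h (lift ord0 i).
  by rewrite !se !ltn_lift.
- move=> i; apply/forallP => k.
  case: (unliftP ord0 i) => [i'|] ->; case: (unliftP ord0 k) => [k'|] -> //.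
    by rewrite !se !ltn_lift; have /forallP := h i'.
  by rewrite s0 se.
Qed.

(** The value 0 cannot sit at an odd position, where it would exceed its partner, nor at a later
    even position, because the entries at even positions increase. *)
Lemma matching0 n (s : 'S_n.*2.+2) : @matching n.+1 s -> s ord0 = ord0.
Proof.
move=> /andP[/forallP h1 /forallP h2].
pose k := (s^-1)%g ord0; have sk : s k = ord0 by rewrite permKV.
have k2 : (k./2 < n.+1)%N by rewrite ltn_half_double.
pose i := Ordinal k2; case: (boolP (odd k)) => ok.
  have := h1 i; rewrite (_ : odd_ord i = k) ?sk //.
  by apply: val_inj; rewrite /= -[RHS]odd_double_half ok.
have ek : even_ord i = k.
  by apply: val_inj; rewrite /= -[RHS]odd_double_half (negPf ok).
case: (posnP k./2) => [k0|kp].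
  rewrite -[RHS]sk; congr (s _).
  by apply: val_inj; rewrite /= -[RHS]odd_double_half (negPf ok) k0.
by have /forallP/(_ i) := h2 ord0; rewrite ek sk kp.
Qed.

(** The matchings are sorted by the partner j + 1 of 0; the inner [lift_perm] accounts for the sign
    (-1)^j. *)
Lemma Pf_expand (R : comPzRingType) n (A : 'M[R]_(n.+1.*2)) :
  Pf A = \sum_(j < n.*2.+1) (-1) ^+ j * A ord0 (lift ord0 j) *
    @Pf R n (\matrix_(i, k) A (lift ord0 (lift j i)) (lift ord0 (lift j k))).
Proof.
rewrite /Pf.
transitivity (\sum_(s : 'S_n.*2.+2 | @matching n.+1 s && (s ord0 == ord0))
   (-1) ^+ s * \prod_(i < n.+1) A (s (even_ord i)) (s (odd_ord i))).
  apply: eq_bigl => s; apply/idP/andP => [h|[]] //.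
  by split=> //; apply/eqP/matching0.
rewrite big_lift_perm (partition_big (fun t : 'S_n.*2.+1 => t ord0) xpredT) //=.
apply: eq_bigr => j _; rewrite big_lift_perm /= big_distrr /=.
apply: eq_big => [t|t _]; first exact: matching_lift.
rewrite !odd_lift_perm /= signr_addb signr_odd -!mulrA; congr (_ * _).
rewrite big_ord_recl !ord_splitE lift_perm_id lift_perm_lift lift_perm_id.
rewrite mulrCA; congr (_ * (_ * _)); apply: eq_bigr => i _.
by rewrite !ord_splitE !lift_perm_lift mxE.
Qed.

Lemma Pf_list (R : comPzRingType) (M : lmodType R) (chi : M -> M -> R^o) n
    (v : 'I_n.*2 -> M) :
  Pf (\matrix_(i, j) chi (v i) (v j)) = pf chi n [seq v i | i <- enum 'I_n.*2].
Proof.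
elim: n v => [|n IH] v.
  rewrite /= enum_ord0 /= /Pf (big_pred1 (1%g : 'S_0)) => [|s].
    by rewrite big_ord0 odd_perm1 mulr1.
  by rewrite permS0 /= eqxx /matching; apply/andP; split; apply/forallP => -[].
rewrite Pf_expand.
have -> : enum 'I_n.+1.*2 = ord0 :: [seq lift ord0 i | i <- enum 'I_n.*2.+1].
  exact: enum_ordSl.
rewrite /= -map_comp.
rewrite (contract_enum chi _ _ (v \o lift ord0)).
apply: eq_bigr => j _; rewrite !mxE; congr (_ * _) => /=.
rewrite -(IH (fun i => v (lift ord0 (lift j i)))); congr Pf.
by apply/matrixP => i k; rewrite !mxE.
Qed.

End PfaffianExpansion.

(** * Isometric embeddings *)

Section Embedding.
Variable R : comPzRingType.
Implicit Types A B P : lmodType R.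

Lemma alternating_iso_perp_psi B (chi : B -> B -> R^o) n :
  alternating_iso chi -> alternating_iso (perp_psi n chi).
Proof. by move=> h; elim: n => //= n IH; apply: alternating_iso_perp_psi2. Qed.

(** In dual coordinates x = sum_j c_j(x) b_j. The plane added for b_k has coordinates g(X_k x, b_k)
    and c_k(x), and its psi_2 supplies the increase from g(X_k x, X_k y) to g(X_(k+1) x, X_(k+1) y).
    The component in [B] is 0. *)
Lemma hyperbolic_embedding B (chi : B -> B -> R^o) P (g : P -> P -> R^o) :
  chi 0 0 = 0 -> fg_projective P -> alt_bilinear g ->
  exists n (h : P -> P_ B n.+1.*2.+2), linear h /\
    forall x y, perp_psi n.+1 chi (h x) (h y) = g x y.
Proof.
move=> chi0 [m [p [s sK]]] hg.
(* Extension by 0 past [m] lets the partial sums [X k] be defined for every k. *)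
pose b j : P := if insub j is Some i then p (delta_mx 0 (i : 'I_m)) else 0.
pose c j (x : P) : R^o := if insub j is Some i then s x 0 (i : 'I_m) else 0.
pose X k (x : P) : P := \sum_(j < k) c j x *: b j.
have cl j : linear (c j).
  move=> a x y; rewrite /c; case: insub => [i|]; first by rewrite linearP !mxE.
  by rewrite scaler0 addr0.
have Xl k : linear (X k).
  move=> a x y; rewrite /X scaler_sumr -big_split; apply: eq_bigr => j _ /=.
  by rewrite cl scalerDl scalerA.
(* The term of index [m] is zero; including it makes the number of planes positive even for m =
   0. *)
have XE x : X m.+1 x = x.
  rewrite /X big_ord_recr /= {2}/c insubF ?ltnn // scale0r addr0.
  rewrite -[RHS]sK [s x]row_sum_delta linear_sum; apply: eq_bigr => j _.
  by rewrite linearZ /= /c /b valK.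
suff [h [hl hE]] : exists h : P -> P_ B m.+1.*2.+2, linear h /\
    forall x y, perp_psi m.+1 chi (h x) (h y) = g (X m.+1 x) (X m.+1 y).
  by exists m, h; split=> // x y; rewrite hE !XE.
elim: m.+1 => [|k [h [hl hE]]].
  exists (fun=> 0); split=> [a x y|x y]; first by rewrite scaler0 addr0.
  by rewrite /X !big_ord0 (ab0l hg).
pose h' x : P_ B k.+1.*2.+2 := (h x, g (X k x) (b k), c k x).
exists h'; split=> [a x y|x y].
  by rewrite /h' hl cl Xl (ab_linearl hg).
rewrite /= /perp_psi2 /= hE /X !big_ord_recr /= -/(X k x) -/(X k y).
rewrite !(abDl hg) !(abDr hg) !(abZl hg) !(abZr hg) (ab_alt hg).
by rewrite (abC hg (b k)) /GRing.scale /=; ring.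
Qed.

(** [g] represents the functional p |-> w(h p, z); uniqueness of the representing vector makes it
    linear in [z]. *)
Lemma adjoint A P (w : A -> A -> R^o) (g : P -> P -> R^o) (h : P -> A) :
  alternating_iso g -> alt_bilinear w -> linear h ->
  exists f : A -> P, linear f /\ forall p z, g p (f z) = w (h p) z.
Proof.
move=> hg hw hl; have hG := alternating_iso_bilinear hg.
have wl z : linear (fun p => w (h p) z).
  by move=> a x y; rewrite hl (ab_linearl hw).
have ex z : {q | forall p, g p q = w (h p) z}.
  apply: cid; have [q [hq _]] := alt_bijective hg (to_linear (wl z)).
  by exists q.
exists (fun z => sval (ex z)); split=> [a x y|p z]; last exact: (svalP (ex z)).
apply/eqP; rewrite -subr_eq0; apply/eqP; apply: (alternating_iso_nondegenerate hg) => p.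
rewrite (abDr hG) (abNr hG) (ab_linearr hG).
by rewrite !(svalP (ex _)) (ab_linearr hw) subrr.
Qed.

Section Isometric.
Variables (A P : lmodType R) (w : A -> A -> R^o) (g : P -> P -> R^o).
Variables (h : P -> A) (k : A -> P).
Hypotheses (hw : alternating_iso w) (hg : alternating_iso g).
Hypotheses (hl : linear h) (kl : linear k).
Hypothesis hE : forall x y, w (h x) (h y) = g x y.
Hypothesis kE : forall p z, g p (k z) = w (h p) z.

Let hW := alternating_iso_bilinear hw.
Let hG := alternating_iso_bilinear hg.

Lemma adjointK : cancel h k.
Proof.
move=> y; apply/eqP; rewrite -subr_eq0; apply/eqP; apply: (alternating_iso_nondegenerate hg) => p.
by rewrite (abDr hG) (abNr hG) kE hE subrr.
Qed.

(** By [hE] and [kE], [h (k z)] is the orthogonal projection of [z] to the image of [h]. *)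
Definition orth z := z - h (k z).

Lemma orth_linear : linear orth.
Proof.
by move=> a x y; rewrite /orth kl hl opprD -scalerN addrACA -scalerDr.
Qed.

Lemma orthE p z : w (h p) (orth z) = 0.
Proof. by rewrite (abDr hW) (abNr hW) hE kE subrr. Qed.

Lemma orth_image p : orth (h p) = 0.
Proof. by rewrite /orth adjointK subrr. Qed.

Lemma adjoint_orth z : k (orth z) = 0.
Proof. by rewrite /orth (linB kl) adjointK subrr. Qed.

Lemma orthK z : orth (orth z) = orth z.
Proof. by rewrite {1}/orth adjoint_orth (lin0 hl) subr0. Qed.

Lemma orth_split z z' : w (orth z) (orth z') + g (k z) (k z') = w z z'.
Proof.
rewrite -[in RHS](subrK (h (k z)) z) -[in RHS](subrK (h (k z')) z').
rewrite -/(orth z) -/(orth z').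
move: (orth z) (orth z') (orthE (k z) z') (orthE (k z') z) => u u' ku' k'u.
rewrite (abDl hW) !(abDr hW) hE ku' (abC hW u (h _)) k'u.
by rewrite oppr0 addr0 add0r.
Qed.

Variables (pA : fg_projective A) (pP : fg_projective P).
Variables (f : P -> P -> R^o) (hf : alternating_iso f).

Let hF := alternating_iso_bilinear hf.

(** This keeps [w] on the orthogonal complement of the image of [h] and puts [f] in place of [g] on
    the image. *)
Definition transplant z z' : R^o := w (orth z) (orth z') + f (k z) (k z').

(* The involution (z, p) |-> (orth z + h p, k z) of A (+) P exchanges the two
   copies of (P, g). It is an isometry of w _|_ g and takes w _|_ f to
   transplant _|_ g. *)
Lemma bracket_embedding :
  alternating_iso transplant /\ bracket P g f = bracket A w transplant.
Proof.
pose a (x : (A * P)%type) : (A * P)%type := (orth x.1 + h x.2, k x.1).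
have al : linear a.
  move=> r x y; rewrite /a /= orth_linear hl kl; congr pair.
  by rewrite /= [in RHS]scalerDr [LHS]addrACA.
have a1 z p : orth (orth z + h p) = orth z.
  by rewrite (linD orth_linear) orthK orth_image addr0.
have a2 z p : k (orth z + h p) = p by rewrite (linD kl) adjoint_orth adjointK add0r.
have aK : cancel a a by move=> [z p]; rewrite /a /= a1 a2 subrK.
have ab : bijective a by exists a.
have aw : pullback a (perp w g) = perp w g.
  apply/funext => -[z p]; apply/funext => -[z' p'].
  rewrite /pullback /perp /= -(orth_split (orth z + h p)) !a1 !a2.
  by rewrite -(orth_split z) addrAC.
have af : pullback a (perp transplant g) = perp w f.
  apply/funext => -[z p]; apply/funext => -[z' p'].
  rewrite /pullback /perp /= /transplant !a1 !a2.
  by rewrite -(orth_split z) addrAC.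
(* As [a] is an involution, this sum is in turn a pullback of w _|_ f, hence non-degenerate. *)
have ht' : alternating_iso (perp transplant g).
  have -> : perp transplant g = pullback a (perp w f).
    rewrite -af pullback_comp; apply/funext => x; apply/funext => y.
    by rewrite /pullback /= !aK.
  exact: (alternating_iso_pullback al ab (alternating_iso_perp hw hf)).
have ht := alternating_iso_perpl hG ht'; split=> //.
have := bracket_perp pA pP hw hw hg hf; rewrite (bracket_self pA hw) Vadd0 => <-.
have := bracket_perp pA pP hw ht hg hg; rewrite (bracket_self pP hg) Vaddx0 => <-.
have pAP := fg_projective_prod pA pP.
rewrite -(bracket_pullback pAP pAP al ab _ ht') ?aw ?af //.
exact: alternating_iso_perp.
Qed.

End Isometric.
End Embedding.

(** * Pfaffians on hyperbolic spaces *)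

Section FreeModule.
Variable R : comPzRingType.

(** Over the zero module, [P_] is a free module of rank 2n and [perp_psi] is its standard hyperbolic
    form. *)
Let Z : lmodType R := 'rV[R]_0.
Let F n : lmodType R := P_ Z n.*2.+2.

Definition std_form n : F n -> F n -> R^o := perp_psi n (fun _ _ : Z => 0).

Lemma rV0_eq0 (z : Z) : z = 0.
Proof. exact: thinmx0. Qed.

Lemma std_form_alternating_iso n : alternating_iso (@std_form n).
Proof.
apply: alternating_iso_perp_psi; apply: alternating_isoI.
- by split=> [q a x y|p a x y|p] //=; rewrite scaler0 addr0.
- by move=> q _; apply: rV0_eq0.
- by move=> l; exists 0 => p; rewrite (rV0_eq0 p) linear0.
Qed.

Definition hyp_in n (z : F n) : F n.+1 := (z, 0, 0).
Definition hyp_e n : F n.+1 := (0, 1, 0).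
Definition hyp_f n : F n.+1 := (0, 0, 1).

Fixpoint std_basis n : seq (F n) :=
  match n with
  | 0 => [::]
  | n'.+1 => hyp_e n' :: hyp_f n' :: map (@hyp_in n') (std_basis n')
  end.

Lemma hyp_in_linear n : linear (@hyp_in n).
Proof. exact: inl2_linear. Qed.

Lemma F_split n (z : F n.+1) : z = hyp_in z.1.1 + z.1.2 *: hyp_e n + z.2 *: hyp_f n.
Proof.
case: z => [[z r] t].
rewrite [RHS](_ : _ = (z + r *: 0 + t *: 0, 0 + r * 1 + t * 0,
                       0 + r * 0 + t * 1)) //.
by rewrite !scaler0 !mulr0 !mulr1 !addr0 !add0r.
Qed.

Lemma alt_list_hyp n (f : seq (F n.+1) -> R^o) x y :
  alt_list f -> alt_list (fun l => f (x :: y :: map (@hyp_in n) l)).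
Proof.
move=> hf.
exact: (alt_list_map (@hyp_in_linear n) (alt_list_cons y (alt_list_cons x hf))).
Qed.

(** There is one vector more than the rank: expanding [z] in the basis leaves only terms with a
    repeated vector. *)
Lemma std_basis_span n (f : seq (F n) -> R^o) z :
  alt_list f -> f (z :: std_basis n) = 0.
Proof.
elim: n f z => [|n IH] f z hf.
  by rewrite (rV0_eq0 z); apply: (lin0 (al_linear hf [::] [::])).
rewrite [z]F_split [std_basis _]/=; set z' := z.1.1.
rewrite -[hyp_f n]scale1r -addrA.
have e a x y l : f ((x + a *: y) :: l) = f (x :: l) + a * f (y :: l).
  by rewrite addrC [LHS](al_linear hf [::]) addrC.
rewrite scale1r addrA !e (al_alt hf [::]) (al_rep hf [::] _ [:: _]) !mulr0 !addr0.
by rewrite (al_move2 hf [:: _]) (IH _ z' (alt_list_hyp _ _ hf)).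
Qed.

(* An alternating multilinear functional of all but two arguments z, w running
   over complementary basis vectors recovers its value on the basis times the
   Plucker coordinates occurring in std_form z w. *)
Lemma std_basis_expand n (z w : F n) : exists ls : seq (seq (F n)),
  forall f, alt_list f ->
    f (std_basis n) * std_form z w = \sum_(l <- ls) f (z :: w :: l).
Proof.
elim: n z w => [|n IH] z w.
  by exists [::] => f _; rewrite big_nil mulr0.
have [ls hls] := IH z.1.1 w.1.1.
(* On the lists containing the new pair only the components of [z] and [w] in [F n] count; on the
   last list, which fills [F n], only those along the new pair count. *)
exists ([seq hyp_e n :: hyp_f n :: map (@hyp_in n) l | l <- ls] ++
        [:: map (@hyp_in n) (std_basis n)]) => f hf.
have D l1 (v : F n.+1) l2 : f (l1 ++ v :: l2) = f (l1 ++ hyp_in v.1.1 :: l2) +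
    v.1.2 * f (l1 ++ hyp_e n :: l2) + v.2 * f (l1 ++ hyp_f n :: l2).
  rewrite {1}[v]F_split (linD (al_linear hf l1 l2)) (linD (al_linear hf l1 l2)).
  by rewrite !(linZ (al_linear hf l1 l2)).
have hf2 := alt_list_hyp (hyp_e n) (hyp_f n) hf.
have S x y : f (x :: hyp_in y :: map (@hyp_in n) (std_basis n)) = 0.
  exact: (std_basis_span _ (alt_list_map (@hyp_in_linear n) (alt_list_cons x hf))).
rewrite big_cat big_seq1 big_map /=.
have -> : f (z :: w :: map (@hyp_in n) (std_basis n)) =
    (z.1.2 * w.2 - z.2 * w.1.2) * f (std_basis n.+1).
  rewrite (D [::] z) /= (al_swap hf [::]) S oppr0 add0r.
  rewrite (D [:: hyp_e n] w) (D [:: hyp_f n] w) /= !S !(al_alt hf [::]).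
  rewrite (al_swap hf [::] (hyp_f n)) /=; ring.
have -> : \sum_(l <- ls) f (z :: w :: hyp_e n :: hyp_f n :: map (@hyp_in n) l) =
          \sum_(l <- ls) f (hyp_e n :: hyp_f n :: map (@hyp_in n) (z.1.1 :: w.1.1 :: l)).
  apply: eq_bigr => l _; set L := map _ l.
  rewrite (D [::] z) (D [:: hyp_in _] w) /= -(al_move2 hf [:: _; _]) /=.
  rewrite !(al_rep hf [::] _ [:: _]) !(al_rep hf [::] _ [:: _; _]).
  rewrite (al_rep hf [:: _] _ [::]) (al_rep hf [:: _] _ [:: _]) !mulr0 !addr0.
  by [].
rewrite -(hls _ hf2) /= /std_form /= /perp_psi2 /=; ring.
Qed.

Lemma std_formS n (z w : F n.+1) : std_form z w =
  std_form (z.1.1 : F n) (w.1.1 : F n) + (z.1.2 * w.2 - z.2 * w.1.2).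
Proof. by []. Qed.

Lemma pf_std_basis n : pf (@std_form n) n (std_basis n) = 1.
Proof.
elim: n => [|n IH] //.
have h := alternating_iso_bilinear (std_form_alternating_iso n).
rewrite [std_basis _]/= pf_head2 => [|_ /mapP[z _ ->]]; rewrite std_formS /=.
  rewrite pf_map (_ : pullback _ _ = @std_form n) ?IH ?(ab0l h).
    by rewrite !mulr1 mul0r subr0 add0r.
  apply/funext => x; apply/funext => y.
  by rewrite /pullback std_formS /= !mulr0 subrr addr0.
by rewrite (ab0l h) !mulr0 subrr addr0.
Qed.

(** [is_pfaffian_hom] speaks of row vectors; this isomorphism turns their Gram matrices into those
    of [std_basis]. *)
Lemma std_coordinates n : exists J : 'rV[R]_n.*2 -> F n,
  [/\ linear J, bijective J &
      [seq J (delta_mx 0 i) | i <- enum 'I_n.*2] = std_basis n].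
Proof.
elim: n => [|n [J [Jl [K JK KJ] JE]]].
  exists id; split=> //; first by exists id.
  by rewrite /= enum_ord0.
pose tl (v : 'rV[R]_n.*2.+2) : 'rV[R]_n.*2 := \row_j v 0 (lift ord0 (lift ord0 j)).
pose J' (v : 'rV[R]_n.*2.+2) : F n.+1 := (J (tl v), v 0 ord0, v 0 (lift ord0 ord0)).
have tll : linear tl by move=> a x y; apply/rowP => j; rewrite !mxE.
exists J'; split.
- by move=> a x y; rewrite /J' tll Jl !mxE.
- pose K' (x : F n.+1) : 'rV[R]_n.*2.+2 := \row_i
    if unlift ord0 i is Some i' then
      if unlift ord0 i' is Some j then K x.1.1 0 j else x.2
    else x.1.2.
  exists K' => [v|[[x r] t]].
    apply/rowP => i; rewrite mxE.
    case: unliftP => [i' ->|-> //]; case: unliftP => [j ->|-> //].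
    by rewrite /= JK mxE.
  rewrite /J' !mxE !unlift_none liftK unlift_none /=; congr (_, _, _).
  rewrite -[RHS]KJ; congr J; apply/rowP => j.
  by rewrite !mxE !liftK.
- have -> : enum 'I_n.+1.*2 = ord0 :: lift ord0 ord0 ::
      [seq lift ord0 (lift ord0 i) | i <- enum 'I_n.*2].
    by rewrite [LHS]enum_ordSl enum_ordSl /= -map_comp.
  rewrite /= -map_comp -JE -map_comp; congr [:: _, _ & _].
  + rewrite /J' /hyp_e !mxE /= (_ : tl _ = 0) ?(lin0 Jl) //.
    by apply/rowP => j; rewrite !mxE.
  + rewrite /J' /hyp_f !mxE /= (_ : tl _ = 0) ?(lin0 Jl) //.
    by apply/rowP => j; rewrite !mxE.
  + apply: eq_map => i; rewrite /J' /hyp_in /= !mxE /=; congr (_, _, _); congr J.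
    by apply/rowP => j; rewrite !mxE /= !(inj_eq lift_inj).
Qed.

Lemma pfaffian_hom_std (phi : V R -> R) n (w : F n -> F n -> R^o) :
  is_pfaffian_hom phi -> alternating_iso w ->
  phi (bracket (F n) (@std_form n) w) = pf w n (std_basis n).
Proof.
move=> [_ _ hphi] hw; have [J [Jl Jb JE]] := std_coordinates n.
have hs := std_form_alternating_iso n.
have := hphi n _ _ (alternating_iso_pullback Jl Jb hs)
  (alternating_iso_pullback Jl Jb hw).
have pF : fg_projective (F n).
  exact: (fg_projective_add_free _ (fg_projective_rV _ 0)).
rewrite (bracket_pullback (fg_projective_rV _ _) pF Jl Jb hs hw).
have gramE (u : F n -> F n -> R^o) : Pf (gram (pullback J u)) = pf u n (std_basis n).
  by rewrite -JE -(Pf_list u (fun i => J (delta_mx 0 i))).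
by rewrite !gramE pf_std_basis mulr1.
Qed.

End FreeModule.

(** * Alternating maps in rank two *)

Section LocalVanishing.
Variable R : comPzRingType.

(** Zorn's lemma yields a maximal ideal containing [J], and such an ideal is prime. *)
Lemma prime_ideal_above (J : set R) :
  J 0 -> (forall x y, J x -> J y -> J (x + y)) ->
  (forall a x, J x -> J (a * x)) -> ~ J 1 ->
  exists2 p, prime_ideal p & J `<=` p.
Proof.
move=> J0 JD JM J1.
(* Containment of [J] is asked of non-empty sets only, because the union of the empty chain is
   empty. *)
pose I (A : set R) := [/\ forall x y, A x -> A y -> A (x + y),
  forall a x, A x -> A (a * x), ~ A 1 & forall x, A x -> J `<=` A].
have [F FI Ftot|A [[AD AM A1 AJ] Amax]] := @Zorn_bigcup R I.
  split=> [x y [A FA Ax] [B FB By]|a x [A FA Ax]|[A FA]|x [A FA Ax]].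
  - have [AB|BA] := Ftot A B FA FB.
      by exists B => //; have [BD _ _ _] := FI B FB; apply: BD (AB _ Ax) By.
    by exists A => //; have [AD _ _ _] := FI A FA; apply: AD Ax (BA _ By).
  - by exists A => //; have [_ AM _ _] := FI A FA; apply: AM.
  - by have [_ _ A1 _] := FI A FA.
  - by move=> j Jj; exists A => //; have [_ _ _ AJ] := FI A FA; apply: AJ Ax j Jj.
(* Otherwise the maximal member would be empty, and [J] itself would exceed it. *)
have JA : J `<=` A.
  apply: contrapT => nJA; apply: (Amax J); last by split=> // x _.
  by split=> // x /AJ.
exists A => //; split=> //; first exact: JA.
(* By maximality, the ideal generated by [A] and [x] contains 1. *)
have ext x : ~ A x -> exists r s, A r /\ r + s * x = 1.
  move=> nAx; pose B : set R := [set y | exists r s, A r /\ y = r + s * x].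
  have AB : A `<=` B by move=> r Ar; exists r, 0; rewrite mul0r addr0.
  have A0 := JA 0 J0.
  have Bx : B x by exists 0, 1; rewrite mul1r add0r.
  apply: contrapT => nB; apply: (Amax B).
    by split=> // BA; apply/nAx/BA.
  split=> [y z [r [s [Ar ->]]] [r' [s' [Ar' ->]]]|b y [r [s [Ar ->]]]|[r [s [Ar e]]]|y _].
  - by exists (r + r'), (s + s'); split; [exact: AD|ring].
  - by exists (b * r), (b * s); split; [exact: AM|ring].
  - by apply: nB; exists r, s.
  - by move=> j Jj; apply/AB/JA.
move=> x y Axy; apply: contrapT => /not_orP[nx ny].
have [r [s [Ar e]]] := ext x nx; have [r' [s' [Ar' e']]] := ext y ny.
apply: A1; have -> : 1 = (r' + s' * y) * r + (s * x) * r' + (s * s') * (x * y).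
  by rewrite -[1]mul1r -{1}e -{1}e'; ring.
by apply: (AD _ _ (AD _ _ _ _)); apply: AM.
Qed.

(** Otherwise the annihilator of [z] is a proper ideal, and no element outside a prime containing it
    kills [z]. *)
Lemma vanishing_locally (N : lmodType R) (z : N) :
  (forall p, prime_ideal p -> vanishes_at p z) -> z = 0.
Proof.
move=> hz; apply: contrapT => nz.
have [||||p pp Jp] := @prime_ideal_above [set r | r *: z = 0].
- by rewrite /= scale0r.
- by move=> x y /= hx hy; rewrite scalerDl hx hy addr0.
- by move=> a x /= hx; rewrite -scalerA hx scaler0.
- by rewrite /= scale1r.
by have [u pu uz] := hz p pp; apply/pu/Jp.
Qed.

End LocalVanishing.

Section Trilinear.
Variables (R : comPzRingType).
Implicit Types L M N : lmodType R.

Record alt_trilinear M N (T : M -> M -> M -> N) : Prop := {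
  at_linear1 : forall y z, linear (fun x => T x y z);
  at_linear2 : forall x z, linear (fun y => T x y z);
  at_linear3 : forall x y, linear (T x y);
  at_alt12 : forall x z, T x x z = 0;
  at_alt23 : forall x y, T x y y = 0 }.

Section Theory.
Variables (M N : lmodType R) (T : M -> M -> M -> N) (hT : alt_trilinear T).

Lemma at_swap12 x y z : T x y z = - T y x z.
Proof.
apply/eqP; rewrite -addr_eq0; apply/eqP.
have := at_alt12 hT (x + y) z.
rewrite (linD (at_linear1 hT _ _)) !(linD (at_linear2 hT _ _)).
by rewrite !(at_alt12 hT) add0r addr0.
Qed.

Lemma at_swap23 x y z : T x y z = - T x z y.
Proof.
apply/eqP; rewrite -addr_eq0; apply/eqP.
have := at_alt23 hT x (y + z).
rewrite (linD (at_linear2 hT _ _)) !(linD (at_linear3 hT _ _)).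
by rewrite !(at_alt23 hT) add0r addr0.
Qed.

Lemma at_alt13 x y : T x y x = 0.
Proof. by rewrite at_swap12 (at_alt23 hT) oppr0. Qed.

Lemma at_linear1E a x x' y z : T (a *: x + x') y z = a *: T x y z + T x' y z.
Proof. exact: at_linear1. Qed.
Lemma at_linear2E a x y y' z : T x (a *: y + y') z = a *: T x y z + T x y' z.
Proof. exact: at_linear2. Qed.
Lemma at_linear3E a x y z z' : T x y (a *: z + z') = a *: T x y z + T x y z'.
Proof. exact: at_linear3. Qed.

Definition at_expand := (at_linear1E, at_linear2E, at_linear3E).

Definition at_alt := (at_alt12 hT, at_alt23 hT, at_alt13).

End Theory.

Lemma alt_trilinear_pullback L M N (h : L -> M) (T : M -> M -> M -> N) :
  linear h -> alt_trilinear T ->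
  alt_trilinear (fun x y z => T (h x) (h y) (h z)).
Proof.
move=> hl hT; split=> [y z a u v|x z a u v|x y a u v|x z|x y];
  rewrite ?hl ?at_alt //.
- exact: at_linear1.
- exact: at_linear2.
- exact: at_linear3.
Qed.

(** The exterior product of the functional [l] with the alternating map [B]. *)
Definition functional_wedge M N (l : M -> R^o) (B : M -> M -> N) x y z : N :=
  l x *: B y z - l y *: B x z + l z *: B x y.

Lemma alt_trilinear_functional_wedge M N (l : M -> R^o) (B : M -> M -> N) :
  linear l -> alt_bilinear B -> alt_trilinear (functional_wedge l B).
Proof.
move=> ll hB.
have comb a (A A' C C' E E' : N) : a *: A + A' - (a *: C + C') + (a *: E + E') =
    a *: (A - C + E) + (A' - C' + E').
  by rewrite scalerDr scalerBr opprD [a *: A + A' + _]addrACA [LHS]addrACA.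
have e1 a u v w : l (a *: u + v) *: w = a *: (l u *: w) + l v *: w :> N.
  by rewrite ll scalerDl; congr (_ + _); apply/esym/scalerA.
have e2 r a u v y : r *: B (a *: u + v) y = a *: (r *: B u y) + r *: B v y.
  by rewrite (ab_linearl hB) scalerDr !scalerA mulrC.
have e3 r a u v y : r *: B y (a *: u + v) = a *: (r *: B y u) + r *: B y v.
  by rewrite (ab_linearr hB) scalerDr !scalerA mulrC.
rewrite /functional_wedge; split=> [y z a u v|x z a u v|x y a u v|x z|x y].
- by rewrite e1 !e2 comb.
- by rewrite e1 e2 e3 comb.
- by rewrite e1 !e3 comb.
- by rewrite (ab_alt hB) scaler0 addr0 subrr.
- by rewrite (ab_alt hB) scaler0 sub0r addNr.
Qed.
End Trilinear.

(** At each prime the arguments become, up to factors outside it, combinations of two vectors, and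
    every term of the expansion repeats one of them. *)
Lemma rank2_trilinear0 (R : comPzRingType) (M N : lmodType R)
    (T : M -> M -> M -> N) :
  constant_rank 2 M -> alt_trilinear T -> forall x y z, T x y z = 0.
Proof.
move=> rk hT x y z; apply: vanishing_locally => p pp.
have [e [gen _]] := rk p pp; have [_ _ _ _ pM] := pp.
have gen2 t : exists2 u, ~ p u & exists c d : R, u *: t = c *: e 0 + d *: e 1.
  have [u pu [c e_]] := gen t; exists u => //; exists (c 0), (c 1); rewrite e_.
  by rewrite big_ord_recl big_ord1; congr (_ + c _ *: e _); apply: val_inj.
have [u pu [a [b ux]]] := gen2 x; have [v pv [c [d vy]]] := gen2 y.
have [w pw [f [g wz]]] := gen2 z.
exists (u * (v * w)); first by move=> /pM[//|/pM[]].
have lin1 r t y' z' : T (r *: t) y' z' = r *: T t y' z'.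
  by apply: (linZ (at_linear1 hT _ _)).
have lin2 r t y' z' : T y' (r *: t) z' = r *: T y' t z'.
  by apply: (linZ (at_linear2 hT _ _)).
have lin3 r t y' z' : T y' z' (r *: t) = r *: T y' z' t.
  by apply: (linZ (at_linear3 hT _ _)).
rewrite -!scalerA -lin3 -lin2 -lin1 ux vy wz.
rewrite !(at_expand hT) !(lin1, lin2, lin3) !(at_alt hT).
by rewrite !(scaler0, addr0, add0r).
Qed.

(** * Exterior squares and cubes *)

Section Exterior.
Variable R : comPzRingType.
Implicit Types M N : lmodType R.

Let ord2_0 : 'I_2 := @Ordinal 2 0 isT.
Let ord2_1 : 'I_2 := @Ordinal 2 1 isT.
Let ord3_0 : 'I_3 := @Ordinal 3 0 isT.
Let ord3_1 : 'I_3 := @Ordinal 3 1 isT.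
Let ord3_2 : 'I_3 := @Ordinal 3 2 isT.

Lemma ord2P (i : 'I_2) : i = ord2_0 \/ i = ord2_1.
Proof. by case: i => [[|[|//]] lt]; [left|right]; apply: val_inj. Qed.

Lemma ord3P (i : 'I_3) : [\/ i = ord3_0, i = ord3_1 | i = ord3_2].
Proof.
by case: i => [[|[|[|//]]] lt];
  [apply: Or31|apply: Or32|apply: Or33]; apply: val_inj.
Qed.

Lemma tnth2 M (v : 'I_2 -> M) : v = tnth [tuple v ord2_0; v ord2_1].
Proof. by apply/funext => i; case: (ord2P i) => ->; rewrite !(tnth_nth 0). Qed.

Lemma tnth3 M (v : 'I_3 -> M) : v = tnth [tuple v ord3_0; v ord3_1; v ord3_2].
Proof. by apply/funext => i; case: (ord3P i) => ->; rewrite !(tnth_nth 0). Qed.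

Definition wedge3 M (x y z : M) : ext M 3 := wedge (tnth [tuple x; y; z]).

Lemma wedge2_alt_bilinear M : alt_bilinear (@wedge2 R M).
Proof.
have [wl wa] := wedge_alternating_multilinear M 2; rewrite /wedge2.
split=> [q a x y|p a x y|p].
- have e u : tnth [tuple u; q] = upd (tnth [tuple 0; q]) ord2_0 u.
    by rewrite [RHS]tnth2 /upd /= !(tnth_nth 0).
  by rewrite (e (a *: x + y)) (e x) (e y) wl.
- have e u : tnth [tuple p; u] = upd (tnth [tuple p; 0]) ord2_1 u.
    by rewrite [RHS]tnth2 /upd /= !(tnth_nth 0).
  by rewrite (e (a *: x + y)) (e x) (e y) wl.
- by apply: (wa _ ord2_0 ord2_1) => //; rewrite !(tnth_nth 0).
Qed.

Lemma wedge3_alt_trilinear M : alt_trilinear (@wedge3 M).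
Proof.
have [wl wa] := wedge_alternating_multilinear M 3; rewrite /wedge3.
split=> [y z a u v|x z a u v|x y a u v|x z|x y].
- have e t : tnth [tuple t; y; z] = upd (tnth [tuple 0; y; z]) ord3_0 t.
    by rewrite [RHS]tnth3 /upd /= !(tnth_nth 0).
  by rewrite (e (a *: u + v)) (e u) (e v) wl.
- have e t : tnth [tuple x; t; z] = upd (tnth [tuple x; 0; z]) ord3_1 t.
    by rewrite [RHS]tnth3 /upd /= !(tnth_nth 0).
  by rewrite (e (a *: u + v)) (e u) (e v) wl.
- have e t : tnth [tuple x; y; t] = upd (tnth [tuple x; y; 0]) ord3_2 t.
    by rewrite [RHS]tnth3 /upd /= !(tnth_nth 0).
  by rewrite (e (a *: u + v)) (e u) (e v) wl.
- by apply: (wa _ ord3_0 ord3_1) => //; rewrite !(tnth_nth 0).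
- by apply: (wa _ ord3_1 ord3_2) => //; rewrite !(tnth_nth 0).
Qed.

Lemma ext2_lift M N (B : M -> M -> N) : alt_bilinear B ->
  exists g : {linear ext M 2 -> N}, forall p q, g (wedge2 p q) = B p q.
Proof.
move=> hB; suff hf : alternating_multilinear (fun v : 'I_2 -> M => B (v ord2_0) (v ord2_1)).
  by exists (ext_lift hf) => p q; rewrite ext_liftE !(tnth_nth 0).
split=> [v i a x y|v i j].
  case: (ord2P i) => ->; rewrite /upd /=.
    exact: ab_linearl.
  exact: ab_linearr.
case: (ord2P i) => ->; case: (ord2P j) => -> // _ e.
  by rewrite e (ab_alt hB).
by rewrite e (ab_alt hB).
Qed.

Lemma ext3_lift M N (T : M -> M -> M -> N) : alt_trilinear T ->
  exists g : {linear ext M 3 -> N}, forall x y z, g (wedge3 x y z) = T x y z.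
Proof.
move=> hT; suff hf : alternating_multilinear
    (fun v : 'I_3 -> M => T (v ord3_0) (v ord3_1) (v ord3_2)).
  by exists (ext_lift hf) => x y z; rewrite ext_liftE !(tnth_nth 0).
split=> [v i a x y|v i j].
  case: (ord3P i) => ->; rewrite /upd /=.
  - exact: at_linear1.
  - exact: at_linear2.
  - exact: at_linear3.
by case: (ord3P i) => ->; case: (ord3P j) => -> // _ e; rewrite e (at_alt hT).
Qed.

Lemma ext2_generated M (t : ext M 2) :
  exists s : seq (M * M)%type, t = \sum_(pq <- s) wedge2 pq.1 pq.2.
Proof.
have hB := wedge2_alt_bilinear M.
rewrite -[t]ext_reprK; elim: (ext_repr t) => [v||u [s e]|u [s e] v [s' e']|a u [s e]].
- exists [:: (v ord2_0, v ord2_1)]; rewrite big_seq1 /=.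
  by rewrite /wedge2 -tnth2.
- by exists [::]; rewrite big_nil.
- exists [seq (- pq.1, pq.2) | pq <- s]; rewrite big_map -ext_clsN.
  rewrite -[LHS]/(- ext_cls u) e -sumrN.
  by apply: eq_bigr => pq _; rewrite (abNl hB).
- by exists (s ++ s'); rewrite big_cat -e -e' -ext_clsD.
- exists [seq (a *: pq.1, pq.2) | pq <- s]; rewrite big_map -ext_clsZ.
  rewrite -[LHS]/(a *: ext_cls u) e scaler_sumr.
  by apply: eq_bigr => pq _; rewrite (abZl hB).
Qed.

Lemma ext2_linear_eq M N (f g : ext M 2 -> N) : linear f -> linear g ->
  (forall p q, f (wedge2 p q) = g (wedge2 p q)) -> f =1 g.
Proof.
move=> fl gl fg t; have [s ->] := ext2_generated t.
rewrite -[f _]/(to_linear fl _) -[g _]/(to_linear gl _) !linear_sum.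
by apply: eq_bigr => pq _; apply: fg.
Qed.

Lemma wedge_rightE M N (h : {linear N -> M}) x p q :
  wedge_right 2 h x (wedge2 p q) = wedge3 (h p) (h q) x.
Proof.
rewrite /wedge_right ext_liftE /wedge3; congr wedge; rewrite [LHS]tnth3 /rcons_family.
have -> : ord3_0 = lift ord_max ord2_0 by apply: val_inj.
have -> : ord3_1 = lift ord_max ord2_1 by apply: val_inj.
have -> : ord3_2 = ord_max by apply: val_inj.
by rewrite !liftK unlift_none !(tnth_nth 0).
Qed.

End Exterior.

(** * The form chi_0 and the volume form *)

Section RankTwo.
Variables (R : comPzRingType) (P0 : lmodType R).
Hypotheses (P0_proj : fg_projective P0) (P0_rank2 : constant_rank 2 P0).
Variables (theta0 : {linear R^o -> ext P0 2}) (theta0_bij : bijective theta0).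

Local Notation chi := (chi0 theta0).
Local Notation P3 := (P0 * R^o)%type.

(** [theta0] is onto, so the default value of [inv_of] is never taken. *)
Lemma theta0_chi0 p q : theta0 (chi p q) = wedge2 p q.
Proof.
have [t _ tK] := theta0_bij.
apply: (xgetPex 0 (P := [set r | theta0 r = wedge2 p q])).
by exists (t (wedge2 p q)); apply: tK.
Qed.

Lemma chi0_alt_bilinear : alt_bilinear chi.
Proof.
have hW := wedge2_alt_bilinear P0; have inj := bij_inj theta0_bij.
split=> [q a x y|p a x y|p]; apply: inj.
- by rewrite linearP !theta0_chi0 (ab_linearl hW).
- by rewrite linearP !theta0_chi0 (ab_linearr hW).
- by rewrite linear0 theta0_chi0 (ab_alt hW).
Qed.

(** Obtained by writing [theta0 1] as a sum of wedges; the values of the form thus generate the unit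
    ideal. *)
Lemma chi0_generates : exists s : seq (P0 * P0)%type,
  \sum_(pq <- s) chi pq.1 pq.2 = 1.
Proof.
have [s e] := ext2_generated (theta0 1); exists s.
apply: (bij_inj theta0_bij); rewrite e linear_sum.
by apply: eq_bigr => pq _; apply: theta0_chi0.
Qed.

Lemma chi0_cancel (r : R) : (forall p q, r * chi p q = 0) -> r = 0.
Proof.
move=> h; have [s e] := chi0_generates; rewrite -[r]mulr1 -e mulr_sumr.
by rewrite big1.
Qed.

Lemma alt_bilinear_chi0 (N : lmodType R) (B : P0 -> P0 -> N) : alt_bilinear B ->
  exists n, forall p q, B p q = chi p q *: n.
Proof.
move=> /ext2_lift[g gE]; exists (g (theta0 1)) => p q.
rewrite -gE -theta0_chi0 -!linearZ /=; congr (g (theta0 _)).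
by rewrite /GRing.scale /= mulr1.
Qed.

(** The expression is the exterior product of [l] with [chi], an alternating trilinear map on a
    module of rank two. *)
Lemma chi0_plucker (l : P0 -> R^o) p q r : linear l ->
  l p * chi q r - l q * chi p r + l r * chi p q = 0.
Proof.
move=> ll; have hT := alt_trilinear_functional_wedge ll chi0_alt_bilinear.
exact: (rank2_trilinear0 P0_rank2 hT).
Qed.

Lemma chi0_alternating_iso : alternating_iso chi.
Proof.
have hB := chi0_alt_bilinear; have [s se] := chi0_generates.
apply: alternating_isoI => //.
  move=> q q0; apply: (fg_projective_separated P0_proj) => l.
  rewrite -[LHS]mulr1 -se mulr_sumr big1 // => -[a b] _ /=.
  have := chi0_plucker a b q (fun r x y => linearP l r x y).
  by rewrite !q0 !mulr0 subrr add0r.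
(* By [chi0_plucker] the pair (a, b) contributes l(p) chi(a, b), and these contributions add up to
   l(p). *)
move=> l; exists (\sum_(pq <- s) (l pq.1 *: pq.2 - l pq.2 *: pq.1)) => p.
rewrite -[LHS]/(to_linear (ab_linearr hB p) _) linear_sum.
rewrite -[RHS]mulr1 -se mulr_sumr; apply: eq_bigr => -[a b] _ /=.
rewrite (abDr hB) (abNr hB) !(abZr hB) (abC hB p b) (abC hB p a).
have := chi0_plucker a b p (fun r x y => linearP l r x y).
by rewrite /GRing.scale /= => /eqP; rewrite addr_eq0 => /eqP e; rewrite -[RHS]opprK -e; ring.
Qed.

Definition vol (x y z : P3) : R^o :=
  functional_wedge (fun x : P3 => x.2) (fun x y : P3 => chi x.1 y.1) x y z.

Lemma volE x y z :
  vol x y z = x.2 * chi y.1 z.1 - y.2 * chi x.1 z.1 + z.2 * chi x.1 y.1.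
Proof. by []. Qed.

Lemma vol_alt_trilinear : alt_trilinear vol.
Proof.
apply: alt_trilinear_functional_wedge => //.
exact: (alt_bilinear_pullback (h := fun x : P3 => x.1) _ chi0_alt_bilinear).
Qed.

(** Terms with three arguments in P0 vanish by rank two, those with two along (0, 1) by alternation;
    exactly one argument along (0, 1) remains. *)
Lemma trilinear_vol (N : lmodType R) (T : P3 -> P3 -> P3 -> N) n :
  alt_trilinear T ->
  (forall p q, T (p, 0) (q, 0) (0, 1) = chi p q *: n) ->
  forall x y z, T x y z = vol x y z *: n.
Proof.
move=> hT hn; pose e : P3 := (0, 1); pose i p : P3 := (p, 0).
have il : linear i by move=> k x y; congr pair; rewrite /= scaler0 addr0.
have s (x : P3) : x = x.2 *: e + i x.1.
  case: x => x t; rewrite [RHS](_ : _ = (t *: 0 + x, t * 1 + 0)) //.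
  by rewrite scaler0 add0r mulr1 addr0.
have Ti := rank2_trilinear0 P0_rank2 (alt_trilinear_pullback il hT).
have T2 x y : T (i x) e (i y) = - T (i x) (i y) e by apply: at_swap23.
have T1 x y : T e (i x) (i y) = T (i x) (i y) e.
  by rewrite (at_swap12 hT) T2 opprK.
move=> x y z; rewrite volE {1}[x]s {1}[y]s {1}[z]s.
rewrite !(at_expand hT) !(at_alt hT) !Ti.
rewrite !(scaler0, add0r, addr0) !T1 !T2 !hn scalerN !scalerA -scaleNr -!scalerDl.
by congr (_ *: n); ring.
Qed.

End RankTwo.

(** * The Pfaffian in rank four *)

Section RankFour.
Variables (R : comPzRingType) (P0 : lmodType R).
Hypotheses (P0_proj : fg_projective P0) (P0_rank2 : constant_rank 2 P0).
Variables (theta0 : {linear R^o -> ext P0 2}) (theta0_bij : bijective theta0).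

Local Notation chi := (chi0 theta0).
Local Notation P4 := (P0 * R^o * R^o)%type.

(** The Pfaffian of the Gram matrix of (0, 1, 0), (0, 0, 1), (p, 0, 0), (q, 0, 0), in this order. *)
Definition pf4 (w : P4 -> P4 -> R^o) (p q : P0) : R^o :=
  w (0, 1, 0) (0, 0, 1) * w (p, 0, 0) (q, 0, 0)
  - w (0, 1, 0) (p, 0, 0) * w (0, 0, 1) (q, 0, 0)
  + w (0, 1, 0) (q, 0, 0) * w (0, 0, 1) (p, 0, 0).

(** The Pfaffian is computed in a hyperbolic space containing P_4; the same computation for chi_0
    _|_ psi_2, where the result is 1, removes the contribution of the complement. *)
Lemma pfaffian_hom_rank4 (phi : V R -> R) (w : P4 -> P4 -> R^o) c :
  is_pfaffian_hom phi -> alternating_iso w ->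
  (forall p q, pf4 w p q = c * chi p q) ->
  phi (bracket P4 (perp_psi2 chi) w) = c.
Proof.
move=> hphi hw hc.
have hchi := chi0_alternating_iso P0_proj P0_rank2 theta0_bij.
have hB := alternating_iso_bilinear hchi.
have [//|n [h0 [h0l h0E]]] :=
  @hyperbolic_embedding R 'rV[R]_0 (fun _ _ => 0) P0 chi _ P0_proj hB.
have hs m := alternating_iso_bilinear (std_form_alternating_iso R m).
have [k0 [k0l k0E]] := adjoint hchi (hs n.+1) h0l.
pose F m : lmodType R := P_ 'rV[R]_0 m.*2.+2.
(* [h] is [h0] on P0 and takes the two free lines to the last hyperbolic pair. *)
pose h (x : P4) : F n.+2 := (h0 x.1.1, x.1.2, x.2).
pose k (z : F n.+2) : P4 := (k0 z.1.1, z.1.2, z.2).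
have hl : linear h by move=> a x y; rewrite /h /= h0l.
have kl : linear k by move=> a x y; rewrite /k /= k0l.
have hE x y : std_form (h x) (h y) = perp_psi2 chi x y.
  by rewrite std_formS /= [std_form _ _]h0E.
have kE p z : perp_psi2 chi p (k z) = std_form (h p) z.
  by rewrite /perp_psi2 std_formS /= k0E.
have pF : fg_projective (F n.+2).
  exact: (fg_projective_add_free _ (fg_projective_rV R 0)).
have pP4 : fg_projective P4.
  exact: (@fg_projective_add_free R P0 2 P0_proj).
have hg := alternating_iso_perp_psi2 hchi.
have hS := std_form_alternating_iso R n.+2.
have tP u (hu : alternating_iso u) :=
  bracket_embedding hS hg hl kl hE kE pF pP4 hu.
rewrite (tP w hw).2 pfaffian_hom_std //; last exact: (tP w hw).1.
pose X u := transplant (@std_form R n.+2) h k u.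
rewrite -/(X w); set v := pf (X w) _ _.
(* The values of chi generate the unit ideal, so it is enough to compare after multiplication by
   each chi(p, q). *)
apply/eqP; rewrite -subr_eq0; apply/eqP/(chi0_cancel theta0_bij) => p q.
have [ls lsE] := std_basis_expand (h0 p) (h0 q).
pose o0 := orth h0 k0.
(* The contribution of the orthogonal complement of P0, the same for every form [u] below. *)
pose Y : R := \sum_(l <- ls) pf (@std_form R n.+1) n (map o0 l).
have hK := adjointK hg hE kE.
have key u c' : alternating_iso u -> pf4 u p q = c' * chi p q ->
    pf (X u) n.+2 (std_basis R n.+2) * chi p q = c' * chi p q * Y.
  move=> hu hc'; have hU := alternating_iso_bilinear hu.
  have hX := alternating_iso_bilinear (tP u hu).1.
  have Xh x y : X u (h x) (h y) = u x y.
    rewrite /X /transplant !(orth_image hg hE kE) !hK.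
    by rewrite (ab0l (hs n.+2)) add0r.
  have Xo x z : X u (h x) (orth h k z) = 0.
    rewrite /X /transplant (orth_image hg hE kE) (ab0l (hs n.+2)) add0r.
    by rewrite (adjoint_orth hg kl hE kE) (ab0r hU).
  have Xoo z z' : X u (orth h k z) (orth h k z') =
      std_form (orth h k z) (orth h k z').
    rewrite /X /transplant !(adjoint_orth hg kl hE kE) (ab0r hU) addr0.
    by rewrite !(orthK hg hl kl hE kE).
  have oE z : hyp_in (o0 z) = orth h k (hyp_in z).
    by rewrite /o0 /orth /hyp_in /h /k /=; congr (_, _, _); rewrite subrr.
  have h1 : hyp_e R n.+1 = h (0, 1, 0) by rewrite /h /= (lin0 h0l).
  have h2 : hyp_f R n.+1 = h (0, 0, 1) by rewrite /h /= (lin0 h0l).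
  have h3 x : hyp_in (h0 x) = h (x, 0, 0) by [].
  pose f l := pf (X u) n.+2 (hyp_e R n.+1 :: hyp_f R n.+1 :: map (@hyp_in R n.+1) l).
  have hf : alt_list f := alt_list_hyp _ _ (alt_list_pf hX n.+2).
  (* As a function of p, q and x this is alternating trilinear on P0, hence zero. *)
  have kill l1 x l2 : f (h0 p :: h0 q :: l1 ++ h0 x :: l2) = 0.
    have hT : alt_trilinear (fun a b c => f (h0 a :: h0 b :: l1 ++ h0 c :: l2)).
      split=> [y z a x1 x2|y z a x1 x2|y z a x1 x2|y z|y z].
      - by rewrite h0l [LHS](al_linear hf [::]).
      - by rewrite h0l [LHS](al_linear hf [:: _]).
      - by rewrite h0l [LHS](al_linear hf (_ :: _ :: _)).
      - exact: (al_alt hf [::]).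
      - exact: (al_rep hf [:: _]).
    exact: (rank2_trilinear0 P0_rank2 hT).
  (* By [kill], each further argument may lose its component in P0. *)
  have repl l1 l : f (h0 p :: h0 q :: l1 ++ l) =
      f (h0 p :: h0 q :: l1 ++ map o0 l).
    elim: l l1 => [|z l IH] l1 //=.
    have e : z = o0 z + h0 (k0 z) by rewrite /o0 /orth subrK.
    rewrite {1}e.
    have := linD (al_linear hf (h0 p :: h0 q :: l1) l) (o0 z) (h0 (k0 z)).
    rewrite /= => ->; rewrite kill addr0 -cat_rcons IH cat_rcons.
    by [].
  (* Since [h0] is isometric, chi(p, q) is the factor [std_form (h0 p) (h0 q)] of
     [std_basis_expand]. *)
  rewrite -[chi p q in LHS]h0E -/(@std_form R n.+1 (h0 p) (h0 q)).
  rewrite [LHS](lsE f hf) mulr_sumr; apply: eq_bigr => l _.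
  (* The four leading vectors lie in the image of [h] and the others are orthogonal to it, so
     [pf4 u p q] splits off. *)
  rewrite (repl [::]) /f [map _ _]/= pf_head4.
  - rewrite h1 h2 !h3 !Xh -/(pf4 u p q) hc' -map_comp !pf_map.
    congr (_ * pf _ _ _); apply/funext => z; apply/funext => z'.
    rewrite /pullback /= !oE Xoo -!oE std_formS /= !mul0r subrr addr0.
    by [].
  - by move=> _ /mapP[_ /mapP[z _ ->] ->]; rewrite h1 oE Xo.
  - by move=> _ /mapP[_ /mapP[z _ ->] ->]; rewrite h2 oE Xo.
  - by move=> _ /mapP[_ /mapP[z _ ->] ->]; rewrite h3 oE Xo.
(* Transplanting chi_0 _|_ psi_2 itself gives the standard form, with Pfaffian 1. *)
have chiY : chi p q = chi p q * Y.
  have := key _ 1 hg; rewrite !mul1r => <-; last first.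
    by rewrite /pf4 /perp_psi2 /= !(ab0l hB, ab0r hB); ring.
  rewrite (_ : X _ = @std_form R n.+2) ?pf_std_basis ?mul1r //.
  by apply/funext => z; apply/funext => z'; apply: (orth_split hS hE kE).
by rewrite mulrBl /v (key w c hw (hc p q)) -mulrA -chiY subrr.
Qed.

End RankFour.

(** * The Vaserstein symbol *)

(** With u = (0, 1, 0) and v = (0, 0, 1), the assumption gives w(M, v) = 0 and w(u, v) = 1. The
    pairings w(p, u) with p in [M] come from the transvection p |-> p - w(p, u) v, which does not
    change the class of w' _|_ psi_2. *)
Lemma split_hyperbolic (R : comPzRingType) (M : lmodType R)
    (w : (M * R^o * R^o)%type -> (M * R^o * R^o)%type -> R^o) :
  fg_projective M -> alternating_iso w ->
  (forall p r, w (p, r, 0) (0, 0, 1) = r) ->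
  alternating_iso (fun p q => w (p, 0, 0) (q, 0, 0)) /\
  bracket (M * R^o * R^o)%type (perp_psi2 (fun p q => w (p, 0, 0) (q, 0, 0))) w
    = V0 R.
Proof.
move=> pM hw we; set w' := fun p q => _; have hW := alternating_iso_bilinear hw.
pose N : lmodType R := (M * R^o * R^o)%type.
pose i p : N := (p, 0, 0); pose u : N := (0, 1, 0); pose v : N := (0, 0, 1).
pose nu (x : N) : N := (0, 0, - w (i x.1.1) u).
pose e (x : N) : N := i x.1.1.
have il : linear i := @inl2_linear R M.
have nl : linear nu.
  move=> a x y; rewrite /nu /= il (ab_linearl hW).
  rewrite [RHS](_ : _ = (a *: 0 + 0, a *: (0 : R^o) + 0,
    a *: (- w (i x.1.1) u : R^o) - w (i y.1.1) u)) //.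
  by rewrite !scaler0 !addr0 scalerN opprD.
have el : linear e by move=> a x y; rewrite /e /= il.
have ne : nu \o e =1 nu by [].
have en x : e (nu x) = 0 by [].
have nn x : nu (nu x) = 0 by rewrite /nu /= (ab0l hW) oppr0.
have [tl [g tK gK]] := Aut_transvection nl nn.
have sp (x : N) : x = i x.1.1 + x.1.2 *: u + x.2 *: v.
  case: x => [[p r] t]; rewrite [RHS](_ : _ = (p + r *: 0 + t *: 0,
    0 + r * 1 + t * 0, 0 + r * 0 + t * 1)) //.
  by rewrite !scaler0 !mulr0 !mulr1 !addr0 !add0r.
have iv p : w (i p) v = 0 by apply: we.
have uv : w u v = 1 by apply: we.
have wE : w = pullback (fun x => x + nu x) (perp_psi2 w').
  apply/funext => x; apply/funext => y; rewrite {1}[x]sp {1}[y]sp.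
  rewrite !(abDl hW) !(abDr hW) !(abZl hW) !(abZr hW) !(ab_alt hW).
  rewrite (abC hW v (i _)) (abC hW v u) (abC hW u (i _)) !iv uv.
  rewrite /pullback /perp_psi2 /= !addr0 /GRing.scale /= -/(i _) -/(i _) -/u.
  by rewrite /w' -/(i _) -/(i _); ring.
have w'E : perp_psi2 w' = pullback g w.
  by rewrite wE pullback_comp; apply/funext => x; apply/funext => y;
    rewrite /pullback /= !gK.
have gb : bijective g by exists (fun x => x + nu x).
have h' : alternating_iso (perp_psi2 w').
  by rewrite w'E; apply: alternating_iso_pullback => //; apply: (can_linear tl tK gK).
have pN : fg_projective N := @fg_projective_add_free R M 2 pM.
split; first exact: alternating_iso_perp_psi2_inv.
rewrite {1}wE; exact: (bracket_transvection pN h' nl el ne en).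
Qed.

Section Symbol.
Variables (R : comPzRingType) (P0 : lmodType R).
Hypotheses (P0_proj : fg_projective P0) (P0_rank2 : constant_rank 2 P0).
Variables (theta0 : {linear R^o -> ext P0 2}) (theta0_bij : bijective theta0).

Local Notation chi := (chi0 theta0).
Local Notation vol := (vol theta0).
Local Notation P3 := (P0 * R^o)%type.
Local Notation P4 := (P0 * R^o * R^o)%type.

Section Split.
Variables (a : {linear P3 -> R^o}) (s : {linear R^o -> P3}) (sK : cancel s a).

Definition ker_proj (x : P3) : Ker a := Kernel (kernel_proj_subproof sK x).

Lemma val_ker_proj x : val (ker_proj x) = x - s (a x).
Proof. by []. Qed.

Lemma ker_val (x : Ker a) : a (val x) = 0.
Proof. by apply/eqP; have := valP x; rewrite inE. Qed.

Lemma ker_projK x : ker_proj (val x) = x.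
Proof. by apply: val_inj; rewrite val_ker_proj ker_val linear0 subr0. Qed.

Lemma ker_proj_linear : linear ker_proj.
Proof.
move=> r x y; apply: val_inj; rewrite linearP /= !linearP /=.
by rewrite addrACA -scalerDr.
Qed.

Lemma ker_proj_section r : ker_proj (s r) = 0.
Proof. by apply: val_inj; rewrite val_ker_proj sK subrr linear0. Qed.

Lemma section_scale r : s r = r *: s 1.
Proof. by rewrite -linearZ /=; congr (s _); rewrite /GRing.scale /= mulr1. Qed.

Lemma a_section : a (s 1) = 1.
Proof. exact: sK. Qed.

Lemma det_add_theta0 (r : R) :
  det_add P0 (theta0 r) = r *: det_add P0 (theta0 1).
Proof.
transitivity (det_add P0 (r *: theta0 1)); last exact: linearZZ.
by congr (det_add P0 _); rewrite -linearZZ /GRing.scale /= mulr1.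
Qed.

Lemma wedge3_vol x y z :
  wedge3 x y z = (vol x y z : R) *: det_add P0 (theta0 1).
Proof.
apply: (trilinear_vol P0_rank2 (@wedge3_alt_trilinear R P3)) => p q.
by rewrite -det_add_theta0 theta0_chi0 // [RHS]wedge_rightE.
Qed.

(** The volume form induces a left inverse of r |-> theta0(r) /\ e_3. *)
Lemma vol_det_add : exists g : {linear ext P3 3 -> R^o},
  (forall x y z, g (wedge3 x y z) = vol x y z) /\
  (forall r, g (det_add P0 (theta0 r)) = r).
Proof.
have [g gE] := ext3_lift (vol_alt_trilinear theta0_bij); exists g; split=> // r.
have g1 : g (det_add P0 (theta0 1)) = 1.
  have [l e] := chi0_generates theta0_bij; rewrite -e !linear_sum.
  apply: eq_bigr => pq _; rewrite theta0_chi0 // [X in g X]wedge_rightE gE volE /=.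
  by ring.
by rewrite det_add_theta0 linearZZ g1 /GRing.scale /= mulr1.
Qed.

Lemma det_kerE p q : det_ker a s (wedge2 p q) = wedge3 (val p) (val q) (s 1).
Proof. exact: wedge_rightE. Qed.

(* Contraction with a is a left inverse of w |-> w /\ s(1). *)
Lemma det_ker_inj : injective (det_ker a s).
Proof.
have hB := alt_bilinear_pullback ker_proj_linear (wedge2_alt_bilinear (Ker a)).
have al : linear a by move=> r x y; rewrite linearP.
have [g gE] := ext3_lift (alt_trilinear_functional_wedge al hB).
apply: (can_inj (g := g)); apply: ext2_linear_eq => [r x y|r x y|p q] //.
  by rewrite !linearP.
rewrite det_kerE gE /functional_wedge !ker_val !scale0r subrr add0r.
by rewrite !ker_projK a_section scale1r.
Qed.

Lemma det_ker_surj : exists t, det_ker a s t = det_add P0 (theta0 1).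
Proof.
have hchi := chi0_alternating_iso P0_proj P0_rank2 theta0_bij.
have il : linear (fun p : P0 => (p, 0) : P3).
  by move=> k x y; congr pair; rewrite /= scaler0 addr0.
have ail : linear (fun p : P0 => a (p, 0)) by move=> r x y; rewrite il linearP.
have [q [hq _]] := alt_bijective hchi (to_linear ail).
have [l e] := chi0_generates theta0_bij.
have W x y : det_ker a s (wedge2 (ker_proj x) (ker_proj y)) =
    (vol x y (s 1) : R) *: det_add P0 (theta0 1).
  have hW := @wedge3_alt_trilinear R P3.
  rewrite det_kerE !val_ker_proj -wedge3_vol.
  rewrite (linB (at_linear1 hW _ _)) !(linB (at_linear2 hW _ _)).
  rewrite [s (a x)]section_scale [s (a y)]section_scale.
  have Z1 (r : R) (u v t : P3) : wedge3 (r *: u) v t = r *: wedge3 u v t.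
    exact: (linZ (at_linear1 hW v t) r u).
  have Z2 (r : R) (u v t : P3) : wedge3 v (r *: u) t = r *: wedge3 v u t.
    exact: (linZ (at_linear2 hW v t) r u).
  by rewrite !Z1 !Z2 !(at_alt hW) !scaler0 !subr0.
(* For s(1) = (m, r) the first wedge contributes chi(m, q) = a(m, 0) and the sum over [l]
   contributes r, so the coefficients add up to a(s(1)) = 1. *)
exists (wedge2 (ker_proj (q, 0)) (ker_proj (0, 1)) + (a (0, 1) : R) *:
  \sum_(pq <- l) wedge2 (ker_proj (pq.1, 0)) (ker_proj (pq.2, 0))).
rewrite linearD linearZ linear_sum /= W.
rewrite (eq_bigr (fun pq => (chi pq.1 pq.2 * (s 1).2 : R) *: det_add P0 (theta0 1))).
  rewrite -scaler_suml -mulr_suml e mul1r scalerA -scalerDl.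
  rewrite -[RHS]scale1r; congr (_ *: _); rewrite -[RHS]a_section volE /=.
  have hB := alternating_iso_bilinear hchi.
  rewrite mul0r sub0r mul1r (ab0r hB) mulr0 addr0 (abC hB) opprK hq /=.
  case: (s 1) => m r /=; rewrite [(m, r)](_ : _ = (m, 0) + r *: ((0, 1) : P3)).
    by rewrite linearD linearZ /= mulrC.
  rewrite [RHS](_ : _ = (m + r *: 0, 0 + r * 1)) //.
  by rewrite scaler0 addr0 mulr1 add0r.
by move=> pq _; rewrite W volE /=; congr (_ *: _); ring.
Qed.

(** Once [det_ker] is injective and reaches [det_add P0 (theta0 1)], the values chosen by [inv_of]
    are true preimages, and both sides can be compared in det(P0 (+) R). *)
Lemma chi_kerE (p q : Ker a) : chi_ker theta0 (a := a) s p q = vol (val p) (val q) (s 1).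
Proof.
have [t0 t0E] := det_ker_surj.
have [g [gE g1]] := vol_det_add.
have th r : det_ker a s (theta theta0 a s r) = det_add P0 (theta0 r).
  apply: (xgetPex 0 (P := [set t | det_ker a s t = det_add P0 (theta0 r)])).
  by exists (r *: t0); rewrite det_add_theta0 -t0E; apply: linearZZ.
have ex : theta theta0 a s (vol (val p) (val q) (s 1)) = wedge2 p q.
  by apply: det_ker_inj; rewrite th det_kerE wedge3_vol det_add_theta0.
have := xgetPex 0 (P := [set r | theta theta0 a s r = wedge2 p q]) (ex_intro _ _ ex).
rewrite -/(inv_of 0 (theta theta0 a s) (wedge2 p q)) -/(chi_ker theta0 (a := a) s p q) /= => e.
by rewrite -[LHS]g1 -th e det_kerE gE.
Qed.

Lemma fg_projective_Ker : fg_projective (Ker a).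
Proof.
have p3 : fg_projective P3 by apply: (@fg_projective_add_free R P0 1).
apply: (@fg_projective_iso R P3 (Ker a) (to_linear ker_proj_linear) val) p3.
exact: ker_projK.
Qed.

(** The trilinear map a /\ w equals [vol]. Evaluated at two vectors of P(a) and s(1), it identifies
    the restriction of [w] to P(a) with chi_a. *)
Lemma vaserstein_splitE (w : P4 -> P4 -> R^o) :
  alternating_iso w -> (forall x, w (x, 0) (0, 1) = a x) ->
  (forall p q, pf4 w p q = chi p q) ->
  vaserstein_split theta0 sK = bracket P4 (perp_psi2 chi) w.
Proof.
move=> hw wa wpf; have hW := alternating_iso_bilinear hw.
have hchi := chi0_alternating_iso P0_proj P0_rank2 theta0_bij.
pose I (x : P4) : (Ker a * R^o * R^o)%type := (ker_proj x.1, a x.1, x.2).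
pose K (y : (Ker a * R^o * R^o)%type) : P4 := (val y.1.1 + s y.1.2, y.2).
have IK : cancel I K by move=> [x t]; rewrite /I /K /= subrK.
have KI : cancel K I.
  move=> [[k r] t]; rewrite /I /K /= linearD /= ker_val sK add0r.
  by rewrite (linD ker_proj_linear) ker_projK ker_proj_section addr0.
have Il : linear I by move=> r x y; rewrite /I /= ker_proj_linear linearP.
have Kl := can_linear Il IK KI.
have Ib : bijective I by exists K.
have Kb : bijective K by exists I.
have hw' := alternating_iso_pullback Kl Kb hw.
have il : linear (fun x : P3 => (x, 0) : P4).
  by move=> k x y; congr pair; rewrite /= scaler0 addr0.
(* In the coordinates P(a) (+) R s(1) (+) R e_4, pairing with e_4 is the coordinate along s(1). *)
have [|h1 h2] := split_hyperbolic fg_projective_Ker hw'.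
  move=> k r; rewrite /pullback /K /= [s 0]linear0.
  by rewrite addr0 wa linearD /= [a (kernel_val k)]ker_val sK add0r.
have pP4 : fg_projective P4 := @fg_projective_add_free R P0 2 P0_proj.
have pK4 := @fg_projective_add_free R (Ker a) 2 fg_projective_Ker.
have al : linear a by move=> r x y; rewrite linearP.
have hB3 := alt_bilinear_pullback il hW.
have hT := alt_trilinear_functional_wedge al hB3.
(* It suffices to compare at (p, 0), (q, 0), (0, 1), where a /\ w takes the value [pf4 w p q]. *)
have TV x y z : functional_wedge a (fun x y => w (x, 0) (y, 0)) x y z =
    vol x y z.
  rewrite (trilinear_vol (theta0 := theta0) P0_rank2 (n := (1 : R^o)) hT).
    by rewrite /GRing.scale /= mulr1.
  move=> p q; rewrite -wpf /pf4 /functional_wedge -!wa /GRing.scale /= mulr1.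
  rewrite (abC hW (p, 0, 0) (0, 0, 1)) (abC hW (q, 0, 0) (0, 0, 1)).
  rewrite (abC hW (p, 0, 0) (0, 1, 0)) (abC hW (q, 0, 0) (0, 1, 0)).
  by ring.
have -> : vaserstein_split theta0 sK = bracket P4 (perp_psi2 chi)
   (pullback I (perp_psi2
      (fun p q : Ker a => pullback K w (p, 0, 0) (q, 0, 0)))).
  rewrite /vaserstein_split; congr (bracket _ _ (pullback _ (perp_psi2 _))).
  apply/funext => p; apply/funext => q; rewrite chi_kerE.
  rewrite /pullback /K /= linear0 !addr0.
  rewrite -TV /functional_wedge !ker_val a_section !scale0r subrr add0r.
  by rewrite scale1r.
have hq := alternating_iso_pullback Il Ib (alternating_iso_perp_psi2 h1).
apply: bracket_eqr => //; first exact: alternating_iso_perp_psi2.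
have {2}-> : w = pullback I (pullback K w).
  by rewrite pullback_comp; apply/funext => x; apply/funext => y;
    rewrite /pullback /= !IK.
rewrite bracket_pullback //; exact: alternating_iso_perp_psi2.
Qed.

End Split.
End Symbol.

(** * Reduction to rank four *)

Section Stabilization.
Variables (R : comPzRingType) (P0 : lmodType R).
Hypothesis P0_proj : fg_projective P0.

Lemma summand_inj_linear k (i : summand_index k) : linear (@summand_inj R P0 k i).
Proof.
elim: k i => [|k IH] //= [j|] a x y; last first.
  by rewrite [RHS](_ : _ = (a *: 0 + 0, a *: x + y)) // scaler0 addr0.
by rewrite IH [RHS](_ : _ = (a *: summand_inj x + summand_inj y,
  a *: (0 : R^o) + 0)) // scaler0 addr0.
Qed.

Lemma summand_proj_linear k (i : summand_index k) : linear (@summand_proj R P0 k i).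
Proof. by elim: k i => [|k IH] //= [j|] a x y //=; rewrite IH. Qed.

Lemma summand_injK k (i : summand_index k) :
  cancel (@summand_inj R P0 k i) (@summand_proj R P0 k i).
Proof. by elim: k i => [|k IH] //= [j|] x //=; rewrite IH. Qed.

Lemma summand_orth k (i j : summand_index k) : i <> j ->
  forall x, @summand_proj R P0 k j (@summand_inj R P0 k i x) = 0.
Proof.
elim: k i j => [[] []|k IH] //= [i|] [j|] //= nij x; last first.
  exact: (lin0 (@summand_proj_linear k j)).
by apply: IH => e; apply: nij; rewrite e.
Qed.

Lemma Aut_stabilize m k (phi : add_free P0 k -> add_free P0 k) :
  Aut phi -> Aut (stabilize m phi).
Proof. by move=> h; elim: m => //= m IH; apply: Aut_with_id. Qed.

(** [phi] becomes elementary after m stabilizations; triviality is then carried back one summand at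
    a time. *)
Lemma Einf_stably_trivial n (phi : P_ P0 n -> P_ P0 n) :
  Einf_Aut P0 n phi -> Aut phi /\ stably_trivial phi.
Proof.
move=> [phiA [m phiE]]; split=> //.
have [_] := elementary_stably_trivial (fg_projective_add_free _ P0_proj)
  (@summand_inj_linear _) (@summand_proj_linear _) (@summand_injK _)
  (@summand_orth _) phiE.
elim: m {phiE} => //= m IH st; apply: IH.
apply: stably_trivial_destabilize st.
  exact: fg_projective_add_free.
exact: Aut_stabilize.
Qed.

Lemma pi_last n (x : P_ P0 n.+2.*2.+1) : pi_ P0 n.+2.*2.+1 n.+2.*2.+1 x = x.2.
Proof. by rewrite /pi_ /= eqxx. Qed.

End Stabilization.

Lemma last_row_Um (R : comPzRingType) (M : lmodType R)
    (w : (M * R^o)%type -> (M * R^o)%type -> R^o) : alternating_iso w ->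
  exists2 a : {linear M -> R^o}, Um M a & forall x, a x = w (x, 0) (0, 1).
Proof.
move=> hw; have hW := alternating_iso_bilinear hw.
have al : linear (fun x : M => w (x, 0) (0, 1)).
  move=> r x y; rewrite -(ab_linearl hW); congr (w _ _).
  by congr pair; rewrite /= scaler0 addr0.
exists (to_linear al) => // r.
have ll : linear (fun z : (M * R^o)%type => r * z.2 : R^o).
  by move=> k x y; rewrite /= /GRing.scale /=; ring.
have [[x t] [hx _]] := alt_bijective hw (to_linear ll).
(* The pair (x, t) satisfies w((0, 1), (x, t)) = r; the part along (0, 1) pairs to zero with (0, 1),
   and exchanging the arguments gives the sign. *)
exists (- x) => /=.
have -> : (- x, 0) = - (x, t) + t *: ((0, 1) : (M * R^o)%type).
  rewrite [RHS](_ : _ = (- x + t *: 0, - t + t * 1)) //.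
  by rewrite scaler0 addr0 mulr1 addNr.
rewrite (abDl hW) (abZl hW) (ab_alt hW) scaler0 addr0 (abNl hW) (abC hW) opprK hx.
by rewrite /= mulr1.
Qed.

Section Reduction.
Variables (R : comPzRingType) (P0 : lmodType R).
Hypotheses (P0_proj : fg_projective P0) (P0_rank2 : constant_rank 2 P0).
Variables (theta0 : {linear R^o -> ext P0 2}) (theta0_bij : bijective theta0).

Local Notation chi := (chi0 theta0).
Local Notation P4 := (P0 * R^o * R^o)%type.

(** [pf4 w] is an alternating form on P0, hence a multiple c chi_0; the Pfaffian homomorphism takes
    the value c on the class, so c = 1. *)
Lemma vaserstein_preimage (phi : V R -> R) (w : P4 -> P4 -> R^o) :
  is_pfaffian_hom phi -> alternating_iso w ->
  phi (bracket P4 (perp_psi2 chi) w) = 1 ->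
  exists a, vaserstein theta0 a = bracket P4 (perp_psi2 chi) w.
Proof.
move=> hphi hw phi1; have hW := alternating_iso_bilinear hw.
have [a aU aE] := last_row_Um hw.
have il : linear (fun x : (P0 * R^o)%type => (x, 0) : P4).
  by move=> k x y; congr pair; rewrite /= scaler0 addr0.
have al : linear a by move=> r x y; rewrite linearP.
have hT := alt_trilinear_functional_wedge al (alt_bilinear_pullback il hW).
have pE p q : pf4 w p q =
    functional_wedge a (fun x y => w (x, 0) (y, 0)) (p, 0) (q, 0) (0, 1).
  rewrite /pf4 /functional_wedge !aE /GRing.scale /=.
  rewrite (abC hW (p, 0, 0) (0, 0, 1)) (abC hW (q, 0, 0) (0, 0, 1)).
  rewrite (abC hW (p, 0, 0) (0, 1, 0)) (abC hW (q, 0, 0) (0, 1, 0)).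
  by ring.
have hpf : alt_bilinear (pf4 w).
  have jl : linear (fun p : P0 => (p, 0) : (P0 * R^o)%type).
    by move=> k x y; congr pair; rewrite /= scaler0 addr0.
  split=> [q r x y|p r x y|p]; rewrite !pE ?jl.
  - exact: at_linear1.
  - exact: at_linear2.
  - exact: at_alt12.
have [c cE] := alt_bilinear_chi0 theta0_bij hpf.
have c1 : c = 1.
  rewrite -phi1; apply/esym/(pfaffian_hom_rank4 P0_proj P0_rank2 theta0_bij) => //.
  by move=> p q; rewrite cE mulrC.
exists (exist _ a aU); rewrite /vaserstein.
apply: (vaserstein_splitE P0_proj P0_rank2 theta0_bij) => //= p q.
by rewrite cE c1 /GRing.scale /= mulr1.
Qed.

Lemma reduction_step n (w : P_ P0 n.+2.*2.+2 -> P_ P0 n.+2.*2.+2 -> R^o) :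
  translates (pi_ P0 n.+2.*2.+1 n.+2.*2.+1) (Einf_Aut P0 n.+2.*2.+1) =
    Um (P_ P0 n.+2.*2.+1) ->
  alternating_iso w ->
  exists2 w' : P_ P0 n.+1.*2.+2 -> P_ P0 n.+1.*2.+2 -> R^o, alternating_iso w' &
    bracket (P_ P0 n.+2.*2.+2) (perp_psi n.+2 chi) w =
    bracket (P_ P0 n.+1.*2.+2) (perp_psi n.+1 chi) w'.
Proof.
move=> trE hw; pose Q : lmodType R := P_ P0 n.+1.*2.+2.
have hchi := chi0_alternating_iso P0_proj P0_rank2 theta0_bij.
have pQ : fg_projective Q by apply: fg_projective_add_free.
have pQ1 := fg_projective_prod pQ (fg_projective_regular R).
have pQ2 := fg_projective_prod pQ1 (fg_projective_regular R).
have [a aU aE] := @last_row_Um R (Q * R^o)%type w hw.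
move: aU; rewrite -[Um _]trE => -[phi phiE aphi].
have [[phil [psi phiK psiK]] st] := Einf_stably_trivial P0_proj phiE.
have phiA : Aut phi by split=> //; exists psi.
have psiA := Aut_inv phiK psiK phiA.
pose Phi := @with_id R (Q * R^o)%type R^o phi.
pose Psi := @with_id R (Q * R^o)%type R^o psi.
have [Psil Psib] : Aut Psi := Aut_with_id _ psiA.
(* Since [a] is the last projection composed with [phi], pulling back along the inverse of [phi]
   turns pairing with the last basis vector into that projection. *)
pose w1 := pullback Psi w.
have hw1 : alternating_iso w1 by apply: alternating_iso_pullback.
have wE : w = pullback Phi w1.
  rewrite /w1 pullback_comp; apply/funext => -[x t]; apply/funext => -[y t'].
  by rewrite /pullback /Psi /Phi /with_id /= !phiK.
have psi0 : psi 0 = 0 := lin0 psiA.1.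
have [|hw2 e2] := @split_hyperbolic R Q w1 pQ hw1.
  move=> p r; rewrite /w1 /pullback /Psi /with_id /= psi0.
  by rewrite -aE aphi psiK pi_last.
exists (fun p q => w1 (p, 0, 0) (q, 0, 0)) => //.
have hg : alternating_iso (perp_psi n.+1 chi) by apply: alternating_iso_perp_psi.
rewrite -[RHS](bracket_perp_psi2 pQ) //.
have h2 := alternating_iso_perp_psi2 hw2; have hg2 := alternating_iso_perp_psi2 hg.
(* The split form may be replaced by [w1] because of [e2], and [w1] by [w] because [phi] is stably
   trivial. *)
rewrite [RHS](bracket_eqr pQ2 hg2 h2 hw1 e2) wE; apply/esym.
apply: (bracket_eqr pQ2 hg2 hw1); first by rewrite -wE.
exact: (st R^o w1 (fg_projective_regular R) hw1).
Qed.

Lemma reduction n (w : P_ P0 n.+1.*2.+2 -> P_ P0 n.+1.*2.+2 -> R^o) :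
  (forall m, (1 < m <= n.+1)%N ->
     translates (pi_ P0 m.*2.+1 m.*2.+1) (Einf_Aut P0 m.*2.+1) =
     Um (P_ P0 m.*2.+1)) ->
  alternating_iso w ->
  exists2 w' : P4 -> P4 -> R^o, alternating_iso w' &
    bracket (P_ P0 n.+1.*2.+2) (perp_psi n.+1 chi) w =
    bracket P4 (perp_psi2 chi) w'.
Proof.
elim: n w => [|n IH] w trE hw; first by exists w.
have [w1 hw1 ->] := reduction_step (trE n.+2 (leqnn _)) hw.
by apply: IH hw1 => m /andP[m1 mn]; apply: trE; rewrite m1 leqW.
Qed.

End Reduction.

Theorem theorem4p5 (R : comPzRingType) (P0 : lmodType R)
    (P0_proj : fg_projective P0) (P0_rank2 : constant_rank 2 P0)
    (theta0 : {linear R^o -> ext P0 2}) (theta0_bij : bijective theta0) :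
  (forall (N : nat) (beta : V R),
      Vtilde beta ->
      (exists2 chi : P_ P0 N.*2.+2 -> P_ P0 N.*2.+2 -> R^o,
          alternating_iso chi &
          beta = bracket (P_ P0 N.*2.+2) (perp_psi N (chi0 theta0)) chi) ->
      (forall n : nat, (1 < n <= N)%N ->
          translates (pi_ P0 n.*2.+1 n.*2.+1) (Einf_Aut P0 n.*2.+1) =
          Um (P_ P0 n.*2.+1)) ->
      exists a, vaserstein theta0 a = beta)
  /\
  ((forall n : nat, (2 <= n)%N ->
       translates (pi_ P0 n.*2.+1 n.*2.+1) (Einf_Aut P0 n.*2.+1) =
       Um (P_ P0 n.*2.+1)) ->
   forall beta : V R, Vtilde beta -> exists a, vaserstein theta0 a = beta).
Proof.
have hchi := chi0_alternating_iso P0_proj P0_rank2 theta0_bij.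
have hB := alternating_iso_bilinear hchi.
have main N beta : Vtilde beta ->
    (exists2 chi : P_ P0 N.*2.+2 -> P_ P0 N.*2.+2 -> R^o, alternating_iso chi &
        beta = bracket (P_ P0 N.*2.+2) (perp_psi N (chi0 theta0)) chi) ->
    (forall n : nat, (1 < n <= N)%N ->
        translates (pi_ P0 n.*2.+1 n.*2.+1) (Einf_Aut P0 n.*2.+1) =
        Um (P_ P0 n.*2.+1)) ->
    exists a, vaserstein theta0 a = beta.
  move=> [phi hphi phib] [w hw bE] trE.
  suff [w' hw' bE'] : exists2 w', alternating_iso w' &
      beta = bracket (P0 * R^o * R^o)%type (perp_psi2 (chi0 theta0)) w'.
    rewrite bE'; apply: (vaserstein_preimage P0_proj P0_rank2 theta0_bij hphi hw').
    by rewrite -bE'.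
  case: N w hw bE trE => [|n] w hw -> trE.
    (* For N = 0 the form lives on P0; adding psi_2 to both forms moves the class to P_4. *)
    exists (perp_psi2 w); first exact: alternating_iso_perp_psi2.
    exact/esym/bracket_perp_psi2.
  have [w' hw' e] := reduction P0_proj P0_rank2 theta0_bij trE hw.
  by exists w'.
split=> // trE beta hb.
(* A class is a single bracket [P, g, f]; embedding (P, g) in P_(2n+4) and transplanting [f] gives
   the required shape with N = n + 1. *)
have [P [g [f [pP hg hf bE]]]] := V_generator beta.
have [n [h [hl hE]]] := hyperbolic_embedding (chi := chi0 theta0) (ab0l hB 0) pP
  (alternating_iso_bilinear hg).
have hw := alternating_iso_perp_psi n.+1 hchi.
have [k [kl kE]] := adjoint hg (alternating_iso_bilinear hw) hl.
have pA := fg_projective_add_free n.+1.*2 P0_proj.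
have [ht tE] := bracket_embedding hw hg hl kl hE kE pA pP hf.
apply: (main n.+1) => // [|m /andP[m1 _]]; last exact: trE.
by eexists; [exact: ht | rewrite bE tE].
Qed.
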